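(* Let $P(z)\in\mathbb{F}[z]^{m\times n}$ be a matrix polynomial of grade $k\ge2$, let $v(z)$ be a scalar ansatz polynomial of grade $k-1$, and let $L(z)=\mathbb{DL}(P,v)\in\mathbb{F}[z]^{km\times kn}$. Suppose that the set of eigenvalues of $P(z)$ and the set of roots of $v(z)$ (each including possibly infinite eigenvalues or roots) are disjoint, and fix any $\lambda\in\mathbb{F}$ such that $v(\lambda)\ne0$. Then $$\ker P(\lambda)/\ker_\lambda P(z)\;\cong\;\ker L(\lambda)/\ker_\lambda L(z)$$ as vector spaces over $\mathbb{F}$.
   Context: $\mathbb{F}$ is an algebraically closed field of characteristic $0$. A (matrix or scalar) polynomial of grade $g$ is a polynomial of degree at most $g$. An ansatz polynomial of grade $k-1$ is a nonzero scalar polynomial in $\mathbb{F}[z]$ of degree at most $k-1$. Pencil $\mathbb{DL}(P,v)$: with $V(x)=[x^{k-1},\dots,x,1]^T$, it is the unique $L(z)=zL_1+L_0\in\mathbb{F}[z]^{km\times kn}$ such that $$(V(y)^T\otimes I_m)\,L(z)\,(V(x)\otimes I_n)=\frac{P(y)(x-z)v(x)-P(x)(y-z)v(y)}{x-y}.$$ $\lambda\in\mathbb{F}$ is an eigenvalue of $P(z)$ if $\operatorname{rank}P(\lambda)<\operatorname{rank}P(z)$ (the latter rank over $\mathbb{F}(z)$); $\infty$ is an eigenvalue of $P(z)$ of grade $k$ if $0$ is an eigenvalue of $z^kP(z^{-1})$. $v$ of grade $k-1$ has a root at $\infty$ iff $\deg v<k-1$. A right minimal basis of a matrix polynomial $Q(z)\in\mathbb{F}[z]^{a\times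 b}$ is a matrix polynomial $M(z)$ whose columns form a basis of $\ker Q(z)=\{x(z)\in\mathbb{F}(z)^b:Q(z)x(z)=0\}$ over $\mathbb{F}(z)$ with minimal sum of column degrees among polynomial bases. For $\lambda\in\mathbb{F}$, $\ker_\lambda Q(z)\subseteq\mathbb{F}^b$ is the span of the columns of $M(\lambda)$ (independent of the choice of $M$), and $\ker Q(\lambda)\subseteq\mathbb{F}^b$ is the kernel of the constant matrix $Q(\lambda)$. *)

(* Defs.v *)
From HB Require Import structures.
From mathcomp Require Import all_boot all_order all_algebra.
From mathcomp Require Import mxtens.

Set Implicit Arguments.
Unset Strict Implicit.
Unset Printing Implicit Defensive.

Import GRing.Theory.
Local Open Scope ring_scope.
Local Open Scope quotient_scope.

(* The quotient U / W of subspaces of vT, as a left module.  It is formed on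
   the vectors of U modulo those lying in W, so it is the usual quotient when
   W is contained in U. *)
Section QuotientSpace.
Variables (F : fieldType) (vT : vectType F) (U W : {vspace vT}).

Definition insub_vs : {pred subvs_of U} := [pred x | vsval x \in W].

Lemma insub_vsE x : (x \in insub_vs) = (vsval x \in W).
Proof. by []. Qed.

Lemma insub_vs_zmod_closed : zmod_closed insub_vs.
Proof.
split=> [|x y]; rewrite !insub_vsE; first by rewrite linear0 mem0v.
by move=> Wx Wy; rewrite linearB rpredB.
Qed.

HB.instance Definition _ :=
  GRing.isZmodClosed.Build (subvs_of U) insub_vs insub_vs_zmod_closed.

Definition quotv := Quotient.quot insub_vs.

HB.instance Definition _ := GRing.Zmodule.on quotv.

Definition quotv_pi (x : subvs_of U) : quotv := \pi x.

Definition quotv_scale (a : F) (x : quotv) : quotv := quotv_pi (a *: repr x).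

Lemma quotv_pi_eq x y : quotv_pi x = quotv_pi y <-> vsval (x - y) \in W.
Proof.
have E : (quotv_pi x == quotv_pi y) = (vsval (x - y) \in W).
  by rewrite -insub_vsE Quotient.idealrBE.
by rewrite -E; split=> /eqP.
Qed.

Lemma quotv_piD x y : quotv_pi (x + y) = quotv_pi x + quotv_pi y.
Proof. exact: Quotient.pi_add. Qed.

Lemma quotv_reprK x : quotv_pi (repr x) = x.
Proof. exact: reprK. Qed.

Lemma quotv_piZ a x : quotv_pi (a *: x) = quotv_scale a (quotv_pi x).
Proof.
apply/quotv_pi_eq; rewrite -scalerBr linearZ rpredZ //.
by apply/quotv_pi_eq; rewrite quotv_reprK.
Qed.

Lemma quotv_scaleA a b x :
  quotv_scale a (quotv_scale b x) = quotv_scale (a * b) x.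
Proof. by rewrite -[x]quotv_reprK -!quotv_piZ scalerA. Qed.

Lemma quotv_scale1 : left_id 1 quotv_scale.
Proof. by move=> x; rewrite -[x in LHS]quotv_reprK -quotv_piZ scale1r quotv_reprK. Qed.

Lemma quotv_scaleDr : right_distributive quotv_scale +%R.
Proof.
move=> a x y; rewrite -[x]quotv_reprK -[y]quotv_reprK.
by rewrite -quotv_piD -!quotv_piZ scalerDr quotv_piD.
Qed.

Lemma quotv_scaleDl x : {morph quotv_scale^~ x : a b / a + b}.
Proof.
by move=> a b; rewrite -[x]quotv_reprK -!quotv_piZ scalerDl quotv_piD.
Qed.

HB.instance Definition _ := GRing.Zmodule_isLmodule.Build F quotv
  quotv_scaleA quotv_scale1 quotv_scaleDr quotv_scaleDl.

End QuotientSpace.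

Definition lin_isomorphic (F : fieldType) (V1 V2 : lmodType F) : Prop :=
  exists f : {linear V1 -> V2}, bijective f.

Section MatrixPolynomials.
Variable F : fieldType.

Definition eval_mx m n (P : 'M[{poly F}]_(m, n)) (lam : F) : 'M[F]_(m, n) :=
  map_mx (fun p => p.[lam]) P.

Definition frac_mx m n (P : 'M[{poly F}]_(m, n)) :
    'M[{fraction {poly F}}]_(m, n) :=
  map_mx (@FracField.tofrac {poly F}) P.

Definition grade_le g m n (P : 'M[{poly F}]_(m, n)) : Prop :=
  forall i j, (size (P i j) <= g.+1)%N.

Definition ansatz g (v : {poly F}) : bool := (v != 0) && (size v <= g.+1)%N.

(* z^k P(1/z), for P of grade k *)
Definition rev_mx k m n (P : 'M[{poly F}]_(m, n)) : 'M[{poly F}]_(m, n) :=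
  map_mx (fun p : {poly F} => \poly_(i < k.+1) p`_(k - i)) P.

Definition fin_eigenvalue m n (P : 'M[{poly F}]_(m, n)) (lam : F) : bool :=
  (\rank (eval_mx P lam) < \rank (frac_mx P))%N.

(* Points of F u {oo} are encoded in option F, None being oo. *)
Definition eigenvalue_at k m n (P : 'M[{poly F}]_(m, n)) (mu : option F) :=
  if mu is Some lam then fin_eigenvalue P lam
  else fin_eigenvalue (rev_mx k P) 0.

(* Roots of a nonzero polynomial of grade g; deg v = (size v).-1. *)
Definition root_at g (v : {poly F}) (mu : option F) : bool :=
  if mu is Some lam then root v lam else ((size v).-1 < g)%N.

(* F[z][x][y]: the outermost variable is y, the innermost one is z. *)
Local Notation F3 := {poly {poly {poly F}}}.
Definition Z3 : F3 := 'X%:P%:P.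
Definition X3 : F3 := 'X%:P.
Definition Y3 : F3 := 'X.

Definition subst3 (t : F3) (p : {poly F}) : F3 :=
  (map_poly (polyC \o polyC \o polyC) p).[t].

Definition subst3_mx (t : F3) m n (P : 'M[{poly F}]_(m, n)) : 'M[F3]_(m, n) :=
  map_mx (subst3 t) P.

(* V(t) = [t^(k-1), ..., t, 1]^T *)
Definition Vvec k (t : F3) : 'cV[F3]_k := \col_(i < k) t ^+ (k.-1 - i).

(* L = DL(P, v): a pencil satisfying the defining identity, in which the
   denominator x - y has been multiplied out (F[x, y, z] is a domain). *)
Definition is_DL k m n (P : 'M[{poly F}]_(m, n)) (v : {poly F})
    (L : 'M[{poly F}]_(k * m, k * n)) : Prop :=
  grade_le 1 L /\
  (X3 - Y3) *:
    castmx (mul1n m, mul1n n)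
      (((Vvec k Y3)^T *t 1%:M) *m subst3_mx Z3 L *m (Vvec k X3 *t 1%:M))
  = ((X3 - Z3) * subst3 X3 v) *: subst3_mx Y3 P
    - ((Y3 - Z3) * subst3 Y3 v) *: subst3_mx X3 P.

Definition cols (K : fieldType) m n (A : 'M[K]_(m, n)) : seq 'cV[K]_m :=
  [seq col j A | j <- enum 'I_n].

Definition kerv (K : fieldType) m n (A : 'M[K]_(m, n)) : {vspace 'cV[K]_n} :=
  lker (linfun (mulmx A : 'cV[K]_n -> 'cV[K]_m)).

Definition poly_kernel_basis a b r (Q : 'M[{poly F}]_(a, b))
    (M : 'M[{poly F}]_(b, r)) : bool :=
  basis_of (kerv (frac_mx Q)) (cols (frac_mx M)).

Definition col_deg b r (M : 'M[{poly F}]_(b, r)) (j : 'I_r) : nat :=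
  \max_(i < b) (size (M i j)).-1.

Definition right_minimal_basis a b r (Q : 'M[{poly F}]_(a, b))
    (M : 'M[{poly F}]_(b, r)) : Prop :=
  poly_kernel_basis Q M /\
  forall r' (M' : 'M[{poly F}]_(b, r')), poly_kernel_basis Q M' ->
    (\sum_j col_deg M j <= \sum_j col_deg M' j)%N.

(* ker_lam Q, where M is any right minimal basis of Q *)
Definition ker_at b r (M : 'M[{poly F}]_(b, r)) (lam : F) : {vspace 'cV[F]_b} :=
  <<cols (eval_mx M lam)>>%VS.

End MatrixPolynomials.

(* Main.v *)
Require Import Defs.
From HB Require Import structures.
From mathcomp Require Import all_boot all_order all_algebra.
From mathcomp Require Import mxtens ring zify.
Import GRing.Theory.
Local Open Scope ring_scope.

Set Implicit Arguments.
Unset Strict Implicit.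
Unset Printing Implicit Defensive.

(** The minimal bases [M] and [N] stay of full rank at [lam], so the two
quotients have dimensions [rk P - rk P(lam)] and [rk L - rk L(lam)], and it is
enough to show [rk L(lam) = rk P(lam) + (k - 1) rk P] for all [lam]; at a
generic [lam] this gives [rk L = k rk P].

Put [w(x) = (x - lam) v(x)].  Then [L(lam)] is the Bezoutian of [P] and [w], of
grade [k].  Let [U(x)] have as coefficients the blocks of a row [u], let [D]
denote the quotient by [x^k], and let [g] be of degree [k] and coprime to [w].
The row [u L(lam)] is that of the coefficients of [D(w U) P - w D(U P)], and
[u |-> g D(w U) - w D(g U)] maps the left kernel of [L(lam)] bijectively onto
the space of the rows [a] of grade [k - 1] such that [a P = w b] with [b] of
grade [k - 1].  The dimension of that space is found by removing the roots of
[w] one at a time, those at infinity included: a root [t] contributes the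
dimension of the left kernel of [P(t)], since every vector of this kernel is the
value of such an [a].  At the roots of [v], where [P] has full rank, this holds
because the vector extends to a polynomial vector of the left kernel of [P]. *)

(** * Rank and nonvanishing minors *)

Section Minors.
Variable K : fieldType.

(** Minors allow ranks to be compared across evaluation and passage to the fraction field, since
    determinants commute with both. *)
Lemma rank_minor m n (A : 'M[K]_(m, n)) :
  exists f : 'I_(\rank A) -> 'I_m, exists g : 'I_(\rank A) -> 'I_n,
    \det (mxsub f g A) != 0.
Proof.
pose f := maxrankfun A; pose B := rowsub f A.
have Bfree : row_free B by exact: maxrowsub_free.
have BTfull : row_full B^T by rewrite /row_full mxrank_tr.
exists f, (fullrankfun BTfull).
have := fullrowsub_unit BTfull; rewrite -unitmx_tr unitmxE unitfE.
by congr (_ != 0); congr (\det _); apply/matrixP=> i j; rewrite !mxE.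
Qed.

Lemma rank_minor_ge m n q (A : 'M[K]_(m, n)) (f : 'I_q -> 'I_m)
    (g : 'I_q -> 'I_n) :
  \det (mxsub f g A) != 0 -> (q <= \rank A)%N.
Proof.
rewrite -unitfE -unitmxE -row_free_unit => /eqP <-.
have -> : mxsub f g A = rowsub f (rowsub g A^T)^T.
  by apply/matrixP=> i j; rewrite !mxE.
apply: leq_trans (mxrankS (rowsub_sub _ _)) _.
by rewrite mxrank_tr -[X in (_ <= X)%N]mxrank_tr mxrankS // rowsub_sub.
Qed.

End Minors.

(** * Rank of a polynomial matrix at a point *)

Section PolynomialMatrices.
Variable F : fieldType.
Implicit Types (v w : {poly F}) (t lam : F).

Lemma eval_mxE m n (P : 'M[{poly F}]_(m, n)) t : eval_mx P t = map_mx (horner_eval t) P.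
Proof. by []. Qed.

Lemma eval_mxM m n l (A : 'M[{poly F}]_(m, n)) (B : 'M_(n, l)) t :
  eval_mx (A *m B) t = eval_mx A t *m eval_mx B t.
Proof. by rewrite !eval_mxE map_mxM. Qed.

Lemma frac_mx_inj m n : injective (@frac_mx F m n).
Proof.
move=> A B /matrixP eqAB; apply/matrixP=> i j.
by have /eqP := eqAB i j; rewrite !mxE tofrac_eq => /eqP.
Qed.

Lemma det_eval m (A : 'M[{poly F}]_m) t : \det (eval_mx A t) = (\det A).[t].
Proof. by rewrite eval_mxE det_map_mx. Qed.

Lemma det_frac m (A : 'M[{poly F}]_m) :
  \det (frac_mx A) = FracField.tofrac (\det A).
Proof. by rewrite /frac_mx det_map_mx. Qed.

Lemma det_frac_eq0 m (A : 'M[{poly F}]_m) :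
  (\det (frac_mx A) == 0) = (\det A == 0).
Proof. by rewrite det_frac tofrac_eq0. Qed.

Lemma mxsub_eval m n l q (A : 'M[{poly F}]_(m, n)) (f : 'I_l -> 'I_m)
    (g : 'I_q -> 'I_n) t :
  mxsub f g (eval_mx A t) = eval_mx (mxsub f g A) t.
Proof. by apply/matrixP=> i j; rewrite !mxE. Qed.

Lemma mxsub_frac m n l q (A : 'M[{poly F}]_(m, n)) (f : 'I_l -> 'I_m)
    (g : 'I_q -> 'I_n) :
  mxsub f g (frac_mx A) = frac_mx (mxsub f g A).
Proof. by apply/matrixP=> i j; rewrite !mxE. Qed.

(** A minor that is nonzero at [t] is a nonzero polynomial. *)
Lemma rank_eval_le m n (Q : 'M[{poly F}]_(m, n)) t :
  (\rank (eval_mx Q t) <= \rank (frac_mx Q))%N.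
Proof.
have [f [g]] := rank_minor (eval_mx Q t).
rewrite mxsub_eval det_eval => det_t; apply: (@rank_minor_ge _ _ _ _ _ f g).
rewrite mxsub_frac det_frac_eq0.
by apply: contraNneq det_t => ->; rewrite horner0.
Qed.

(** For [h] serves a maximal nonzero minor of [Q]: the rank cannot drop where it does not vanish. *)
Lemma rank_eval_generic m n (Q : 'M[{poly F}]_(m, n)) :
  exists2 h : {poly F}, h != 0 &
    forall t, h.[t] != 0 -> \rank (eval_mx Q t) = \rank (frac_mx Q).
Proof.
have [f [g]] := rank_minor (frac_mx Q); rewrite mxsub_frac det_frac_eq0.
exists (\det (mxsub f g Q)) => // t det_t; apply/eqP.
rewrite eqn_leq rank_eval_le (@rank_minor_ge _ _ _ _ _ f g) //.
by rewrite mxsub_eval det_eval.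
Qed.

(* Cramer's rule on a maximal minor that survives evaluation at [t]. *)
Lemma left_kernel_lift m n (Q : 'M[{poly F}]_(m, n)) t (c : 'rV[F]_m) :
  \rank (eval_mx Q t) = \rank (frac_mx Q) -> c *m eval_mx Q t = 0 ->
  exists2 a : 'rV[{poly F}]_m, a *m Q = 0 & eval_mx a t = c.
Proof.
move=> rkQ cQ0; have [f [g]] := rank_minor (eval_mx Q t).
move: (\rank _) rkQ f g => q rkQ f g; rewrite mxsub_eval det_eval.
set A := mxsub f g Q => det_t.
pose cP : 'rV[{poly F}]_m := map_mx polyC c.
pose E : 'M[{poly F}]_(q, m) := rowsub f 1%:M.
(* The correction is supported on the rows [f] and cancels [\det A *: cP *m Q] on the columns [g].
   It is built from [cP *m Q], so it vanishes at [t] and leaves a nonzero multiple of [c]. *)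
pose a := \det A *: cP - colsub g (cP *m Q) *m \adj A *m E.
have EQ : E *m colsub g Q = A.
  rewrite mul_rowsub_mx mul1mx.
  by apply/matrixP=> i j; rewrite !mxE.
have ag0 : a *m colsub g Q = 0.
  rewrite mulmxBl -!mulmxA EQ mul_adj_mx -scalemxAl mulmx_colsub.
  by rewrite mul_mx_scalar subrr.
have eval_cP : eval_mx cP t = c.
  by apply/matrixP=> i j; rewrite !mxE hornerC.
have eval_a : eval_mx a t = (\det A).[t] *: c.
  rewrite /a eval_mxE map_mxB map_mxZ -!eval_mxE eval_cP.
  have -> : eval_mx (colsub g (cP *m Q) *m \adj A *m E) t = 0.
    rewrite !eval_mxM -mxsub_eval eval_mxM eval_cP cQ0.
    have -> : colsub g (0 : 'rV[F]_n) = 0 by apply/matrixP=> i j; rewrite !mxE.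
    by rewrite !mul0mx.
  by rewrite subr0.
exists ((\det A).[t]^-1%:P *: a); last first.
  rewrite eval_mxE map_mxZ -eval_mxE eval_a /= /horner_eval hornerC.
  by rewrite scalerA mulVf // scale1r.
rewrite -scalemxAl; suff -> : a *m Q = 0 by rewrite scaler0.
(* Over the fraction field the columns [g] already have the rank of [Q] and span all its columns, so
   a row that kills them kills [Q]. *)
have fullg : (frac_mx Q)^T = (frac_mx Q)^T *m pinvmx (frac_mx (colsub g Q))^T
   *m (frac_mx (colsub g Q))^T.
  rewrite mulmxKpV //.
  have sub : ((frac_mx (colsub g Q))^T <= (frac_mx Q)^T)%MS.
    rewrite -mxsub_frac trmx_mxsub; exact: rowsub_sub.
  rewrite -(geq_leqif (mxrank_leqif_sup sub)) mxrank_tr -rkQ.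
  rewrite mxrank_tr; apply: (@rank_minor_ge _ _ _ _ _ f id).
  rewrite mxsub_frac det_frac_eq0.
  apply: contraNneq det_t => detA0.
  suff -> : A = mxsub f id (colsub g Q) by rewrite detA0 horner0.
  by apply/matrixP=> i j; rewrite !mxE.
apply: frac_mx_inj; rewrite /frac_mx map_mxM map_mx0 -/(frac_mx _) -/(frac_mx Q).
rewrite -[frac_mx Q]trmxK fullg trmx_mul trmxK mulmxA -map_mxM ag0.
by rewrite map_mx0 mul0mx.
Qed.

End PolynomialMatrices.

(** * Quotient spaces up to isomorphism *)

Section Quotients.
Variable F : fieldType.

Lemma lin_isomorphic_sym (V1 V2 : lmodType F) :
  lin_isomorphic V1 V2 -> lin_isomorphic V2 V1.
Proof.
move=> [f [g fK gK]]; have g_lin : linear g := can2_linear fK gK.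
pose gM := GRing.isLinear.Build F V2 V1 *:%R g g_lin.
pose gL : {linear V2 -> V1} := HB.pack g gM.
by exists gL, f.
Qed.

Lemma lin_isomorphic_trans (V1 V2 V3 : lmodType F) :
  lin_isomorphic V1 V2 -> lin_isomorphic V2 V3 -> lin_isomorphic V1 V3.
Proof. by move=> [f bij_f] [g bij_g]; exists (g \o f); apply: bij_comp. Qed.

(** The isomorphism is induced by the projection along [W] onto a complement [C] of [W] in [U], read
    in a basis of [C]: on [U] its kernel is [W]. *)
Lemma quotv_isomorphic_rV (vT : vectType F) (U W : {vspace vT}) q :
  (W <= U)%VS -> \dim U = (q + \dim W)%N ->
  lin_isomorphic (quotv U W) 'rV[F]_q.
Proof.
move=> sWU dimU; pose C := (U :\: W)%VS.
have CW : (C :&: W = 0)%VS := capv_diff U W.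
have CWU : (C + W)%VS = U by rewrite addv_diff; apply/addv_idPl.
have {dimU} dimC : \dim C = q.
  by apply/eqP; rewrite -(eqn_add2r (\dim W)) -dimU -CWU dimv_disjoint_sum.
subst q; pose X := vbasis C.
pose phi (x : vT) : 'rV[F]_(\dim C) := \row_i coord X i (daddv_pi C W x).
have phi_lin : linear phi.
  by move=> a x y; apply/rowP=> i; rewrite !mxE !linearP.
have phiB x y : phi (x - y) = phi x - phi y.
  by apply/rowP=> i; rewrite !mxE !linearB.
have phiW x : x \in W -> phi x = 0.
  move=> xW; suff pi0 : daddv_pi C W x = 0.
    by apply/rowP=> i; rewrite !mxE pi0 linear0.
  have := daddv_pi_add CW (subvP (addvSr C W) x xW).
  by rewrite capvC in CW; rewrite (daddv_pi_id CW xW) => /(canRL (addrK _)); rewrite subrr.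
have phi0 x : x \in U -> phi x = 0 -> x \in W.
  move=> xU /rowP x0; have xCW : x \in (C + W)%VS by rewrite CWU.
  rewrite -(daddv_pi_add CW xCW) (coord_vbasis (memv_pi C W x)) big1 ?add0r ?memv_pi //.
  by move=> i _; have := x0 i; rewrite !mxE => ->; rewrite scale0r.
pose f (x : quotv U W) := phi (vsval (repr x)).
have f_pi x : f (quotv_pi W x) = phi (vsval x).
  apply/eqP; rewrite -subr_eq0 -phiB phiW // -linearB /=.
  by apply/quotv_pi_eq; rewrite quotv_reprK.
have f_lin : linear f.
  move=> a x y; rewrite -[x]quotv_reprK -[y]quotv_reprK.
  have -> : a *: quotv_pi W (repr x) + quotv_pi W (repr y)
     = quotv_pi W (a *: repr x + repr y).
    by rewrite quotv_piD quotv_piZ.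
  by rewrite !f_pi linearP phi_lin.
pose fM := GRing.isLinear.Build F (quotv U W) 'rV[F]_(\dim C) *:%R f f_lin.
pose fL : {linear quotv U W -> 'rV[F]_(\dim C)} := HB.pack f fM.
exists fL; pose lift (c : 'rV[F]_(\dim C)) := \sum_i c 0 i *: X`_i.
have liftC c : lift c \in C.
  apply: rpred_sum => i _; apply: rpredZ.
  by rewrite vbasis_mem // mem_nth // size_tuple.
have liftU c : lift c \in U by rewrite -CWU (subvP (addvSl C W)).
exists (fun c => quotv_pi W (Subvs (liftU c))) => [x|c] /=; last first.
  rewrite f_pi /=; apply/rowP=> i; rewrite mxE daddv_pi_id // coord_sum_free //.
  exact: basis_free (vbasisP C).
rewrite -[x]quotv_reprK f_pi; apply/quotv_pi_eq.
set y := repr x; rewrite linearB /=; apply: phi0.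
  by rewrite rpredB ?liftU ?subvsP.
rewrite phiB; apply/eqP; rewrite subr_eq0; apply/eqP/rowP=> i.
rewrite mxE daddv_pi_id // coord_sum_free ?mxE //.
exact: basis_free (vbasisP C).
Qed.

Lemma quotv_isomorphic (vT1 vT2 : vectType F) (U1 W1 : {vspace vT1})
    (U2 W2 : {vspace vT2}) :
  (W1 <= U1)%VS -> (W2 <= U2)%VS ->
  (\dim U1 - \dim W1 = \dim U2 - \dim W2)%N ->
  lin_isomorphic (quotv U1 W1) (quotv U2 W2).
Proof.
move=> sWU1 sWU2 eqd; pose q := (\dim U1 - \dim W1)%N.
apply: (@lin_isomorphic_trans _ 'rV[F]_q).
  by apply: quotv_isomorphic_rV => //; rewrite subnK // dimvS.
apply: lin_isomorphic_sym; apply: quotv_isomorphic_rV => //.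
by rewrite /q eqd subnK // dimvS.
Qed.

End Quotients.

(** * Column spans and kernels of matrices *)

Section ColumnSpaces.
Variable K : fieldType.

Lemma mulmx_sum_col m n (A : 'M[K]_(m, n)) (c : 'cV_n) :
  A *m c = \sum_j c j 0 *: col j A.
Proof.
apply/colP=> i; rewrite !mxE summxE; apply: eq_bigr => j _.
by rewrite !mxE mulrC.
Qed.

Lemma nth_cols m n (A : 'M[K]_(m, n)) (j : 'I_n) : (cols A)`_j = col j A.
Proof. by rewrite (nth_map j) ?size_enum_ord // nth_ord_enum. Qed.

Lemma size_cols m n (A : 'M[K]_(m, n)) : size (cols A) = n.
Proof. by rewrite size_map size_enum_ord. Qed.

Lemma span_colsP m n (A : 'M[K]_(m, n)) v :
  reflect (exists c : 'cV_n, v = A *m c) (v \in <<cols A>>%VS).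
Proof.
have eqX : cols A = [tuple col j A | j < n] :> seq _ by [].
apply: (iffP idP) => [|[c ->]].
  rewrite eqX => /coord_span ->.
  exists (\col_j coord [tuple col j A | j < n] j v).
  rewrite mulmx_sum_col; apply: eq_bigr => j _.
  by rewrite mxE -nth_cols.
rewrite mulmx_sum_col; apply: rpred_sum => j _; apply/rpredZ/memv_span.
by apply: map_f; rewrite mem_enum.
Qed.

Lemma free_colsP m n (A : 'M[K]_(m, n)) :
  reflect (forall c : 'cV_n, A *m c = 0 -> c = 0) (free (cols A)).
Proof.
apply: (iffP (@freeP _ _ _ [tuple col j A | j < n])) => freeA.
  move=> c; rewrite mulmx_sum_col => c0; apply/colP=> j; rewrite mxE.
  apply: (freeA (fun j => c j 0)); rewrite -[RHS]c0.
  by apply: eq_bigr => i _; rewrite -nth_cols.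
move=> k k0 j; have /freeA/colP/(_ j) : A *m (\col_j k j) = 0.
  rewrite mulmx_sum_col -[RHS]k0.
  by apply: eq_bigr => i _; rewrite mxE -nth_cols.
by rewrite !mxE.
Qed.

Lemma free_cols_rank m n (A : 'M[K]_(m, n)) :
  (forall c : 'cV_n, A *m c = 0 -> c = 0) -> \rank A = n.
Proof.
move=> injA; rewrite -mxrank_tr; apply/eqP; rewrite -/(row_free A^T).
rewrite -kermx_eq0; apply/eqP/row_matrixP=> i; rewrite row0.
apply: trmx_inj; rewrite trmx0; apply: injA; apply: trmx_inj.
by rewrite trmx_mul trmxK trmx0 -row_mul mulmx_ker row0.
Qed.

Lemma dim_span_cols m n (A : 'M[K]_(m, n)) : \dim <<cols A>>%VS = \rank A.
Proof.
have -> : <<cols A>>%VS = <<cols (col_base A)>>%VS.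
  apply/vspaceP=> v; apply/span_colsP/span_colsP=> -[c ->].
    by exists (row_base A *m c); rewrite mulmxA mulmx_base.
  exists (pinvmx (row_base A) *m c).
  rewrite -[X in _ = X *m _](mulmx_base A) -mulmxA (mulmxA (row_base A)).
  by rewrite mulmxVp ?mul1mx // row_base_free.
have /eqP -> : free (cols (col_base A)); last by rewrite size_cols.
apply/free_colsP=> c c0.
have fr : row_free (col_base A)^T.
  by rewrite /row_free mxrank_tr; apply: col_base_full.
apply: trmx_inj; rewrite trmx0 -(mulmxKp fr c^T) -trmx_mul c0 trmx0.
by rewrite mul0mx.
Qed.

Lemma mem_kerv m n (A : 'M[K]_(m, n)) v : (v \in kerv A) = (A *m v == 0).
Proof. by rewrite memv_ker lfunE. Qed.

Lemma dim_kerv m n (A : 'M[K]_(m, n)) : \dim (kerv A) = (n - \rank A)%N.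
Proof.
have -> : kerv A = <<cols (kermx A^T)^T>>%VS.
  apply/vspaceP=> v; rewrite mem_kerv; apply/eqP/span_colsP => [Av0|[c ->]].
    have /submxP[D vD] : (v^T <= kermx A^T)%MS.
      by apply/sub_kermxP; rewrite -trmx_mul Av0 trmx0.
    by exists D^T; rewrite -trmx_mul -vD trmxK.
  apply: trmx_inj; rewrite trmx_mul trmx_mul trmxK -mulmxA mulmx_ker.
  by rewrite mulmx0 trmx0.
by rewrite dim_span_cols mxrank_tr mxrank_ker mxrank_tr.
Qed.

(** Matrix identities are easier to carry through a change of basis than [basis_of]. *)
Lemma basis_kervP m n r (A : 'M[K]_(m, n)) (M : 'M[K]_(n, r)) :
  reflect [/\ A *m M = 0, forall c : 'cV_r, M *m c = 0 -> c = 0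
           & r = (n - \rank A)%N]
          (basis_of (kerv A) (cols M)).
Proof.
rewrite basisEfree size_cols dim_kerv; apply: (iffP and3P) => [[]|[]].
  move=> /free_colsP freeM sMA le_r; split=> //.
    apply/matrixP=> i j; suff /colP/(_ i) : A *m col j M = 0.
      by rewrite colE mulmxA -colE !mxE.
    apply/eqP; rewrite -mem_kerv (subvP sMA) //; apply/memv_span.
    by apply: map_f; rewrite mem_enum.
  apply/eqP; rewrite eqn_leq le_r andbT -dim_kerv.
  by rewrite -(free_cols_rank freeM) -dim_span_cols dimvS.
move=> AM freeM rE; split; [exact/free_colsP | | by rewrite -rE].
apply/subvP=> v /span_colsP[c ->]; rewrite mem_kerv mulmxA AM.
by rewrite mul0mx.
Qed.

End ColumnSpaces.

(** * Minimal bases evaluated at a point *)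

Section MinimalBases.
Variable F : fieldType.

Lemma leq_col_deg b r (M : 'M[{poly F}]_(b, r)) i j :
  ((size (M i j)).-1 <= col_deg M j)%N.
Proof. exact: (leq_bigmax (F := fun i => (size (M i j)).-1)). Qed.

(** The matrix [T] has rational entries, so that a column may be divided by ['X - lam%:P]. *)
Lemma poly_kernel_basisM a b r (Q : 'M[{poly F}]_(a, b))
    (M M' : 'M[{poly F}]_(b, r)) (T : 'M[{fraction {poly F}}]_r) :
  poly_kernel_basis Q M -> frac_mx M' = frac_mx M *m T -> T \in unitmx ->
  poly_kernel_basis Q M'.
Proof.
move=> /basis_kervP[QM freeM rE] M'E uT; apply/basis_kervP; split=> //.
  by rewrite M'E mulmxA QM mul0mx.
move=> c; rewrite M'E -mulmxA => /freeM Tc.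
by rewrite -(mulKmx uT c) Tc mulmx0.
Qed.

(* If [M(lam)] killed [c], replacing by [M c / (z - lam)] a column of maximal
   degree among those used by [c] would lower the sum of the degrees. *)
Lemma minimal_basis_eval_inj a b r (Q : 'M[{poly F}]_(a, b))
    (M : 'M[{poly F}]_(b, r)) lam (c : 'cV[F]_r) :
  right_minimal_basis Q M -> eval_mx M lam *m c = 0 -> c = 0.
Proof.
move=> [basM minM] Mc0; apply/eqP; apply: contraT => c_neq0.
have [j1 cj1] : exists j, c j 0 != 0.
  apply/existsP; apply: contraNT c_neq0 => /existsPn c0.
  by apply/eqP/colP=> j; rewrite mxE; apply/eqP/negPn/c0.
have [j cj maxj] := @arg_maxnP _ j1 (fun j => c j 0 != 0) (col_deg M) cj1.
pose D := col_deg M j; pose cP : 'cV[{poly F}]_r := map_mx polyC c.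
pose q := \col_i ((M *m cP) i 0 %/ ('X - lam%:P)).
have qE i : (M *m cP) i 0 = q i 0 * ('X - lam%:P).
  rewrite [q i 0]mxE; apply/eqP; rewrite -dvdp_eq dvdp_XsubCl.
  have /matrixP/(_ i 0) := Mc0; rewrite !mxE /root horner_sum => s0.
  apply/eqP; rewrite -[RHS]s0; apply: eq_bigr => l _.
  by rewrite !mxE hornerM hornerC.
have size_Mc i : (size ((M *m cP)%R i 0%R) <= D.+1)%N.
  rewrite mxE; apply: (leq_trans (size_sum _ _ _)); apply/bigmax_leqP => l _.
  rewrite !mxE mulrC mul_polyC; have [->|cl] := eqVneq (c l 0) 0.
    by rewrite scale0r size_poly0.
  apply: leq_trans (size_scale_leq _ _) _; apply: leq_trans (leqSpred _) _.
  rewrite ltnS; apply: leq_trans (maxj l cl).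
  exact: leq_col_deg.
have size_q i : (size (q i 0%R) <= D)%N.
  have [->|q0] := eqVneq (q i 0) 0; first by rewrite size_poly0.
  have := size_Mc i; rewrite qE size_Mmonic ?monicXsubC //.
  by rewrite size_XsubC addn2.
have freeM : forall d : 'cV_r, frac_mx M *m d = 0 -> d = 0.
  by case/basis_kervP: basM.
(* If [D] were 0, then [q], and with it [M *m cP], would vanish, against the independence of the
   columns of [M]. With [D] positive, the bound [size_q] is a strict drop of the degree. *)
have D_gt0 : (0 < D)%N.
  rewrite lt0n; apply: contraNneq c_neq0 => D0.
  have Mc_eq0 : M *m cP = 0.
    apply/colP=> i; rewrite qE [RHS]mxE; have := size_q i.
    by rewrite D0 leqn0 size_poly_eq0 => /eqP->; rewrite mul0r.
  have : frac_mx cP = 0.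
    by apply: freeM; rewrite -map_mxM Mc_eq0 map_mx0.
  rewrite -[X in _ = X](map_mx0 (@FracField.tofrac {poly F})).
  move/frac_mx_inj/colP => cP0; apply/eqP/colP=> i.
  by have := cP0 i; rewrite !mxE => /eqP; rewrite polyC_eq0 => /eqP.
pose M' := \matrix_(i, l) if l == j then q i 0 else M i l.
(* The identity with column [j] replaced by [c / (z - lam)]; it is invertible because [c j 0] is
   nonzero. *)
pose T : 'M[{fraction {poly F}}]_r := \matrix_(i, l)
  if l == j then FracField.tofrac (cP i 0) / FracField.tofrac ('X - lam%:P)
  else (i == l)%:R.
have Xlam0 : FracField.tofrac ('X - lam%:P) != 0.
  by rewrite tofrac_eq0 polyXsubC_eq0.
have M'E : frac_mx M' = frac_mx M *m T.
  apply/matrixP=> i l; rewrite [LHS]mxE [RHS]mxE [M' i l]mxE.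
  have [lj|lj] := eqVneq l j.
    apply: (mulIf Xlam0); rewrite -tofracM -qE mxE rmorph_sum mulr_suml.
    apply: eq_bigr => s _; rewrite !mxE lj eqxx rmorphM mulrA divfK // mxE.

  rewrite (bigD1 l) //= big1 ?addr0 => [|s sl].
    by rewrite !mxE (negPf lj) eqxx mulr1.
  by rewrite !mxE (negPf lj) (negPf sl) mulr0.
have uT : T \in unitmx.
  rewrite -row_free_unit -kermx_eq0; apply/eqP/row_matrixP=> i0.
  set u := row i0 _; have : u *m T = 0 by rewrite -row_mul mulmx_ker row0.
  move/rowP=> uT0; have u0 l : l != j -> u 0 l = 0.
    move=> lj; have := uT0 l; rewrite !mxE (bigD1 l) //= big1 => [|s sl].
      by rewrite !mxE (negPf lj) eqxx mulr1 addr0.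
    by rewrite !mxE (negPf lj) (negPf sl) mulr0.
  apply/rowP=> l; rewrite row0 [RHS]mxE.
  have [->|/u0//] := eqVneq l j.
  have := uT0 j; rewrite mxE (bigD1 j) //= big1 => [|s sj].
    rewrite !mxE eqxx addr0 => /eqP; rewrite !mulf_eq0 invr_eq0 (negPf Xlam0).
    by rewrite tofrac_eq0 polyC_eq0 (negPf cj) !orbF => /eqP.
  by rewrite u0 // mul0r.
have := minM _ _ (poly_kernel_basisM basM M'E uT).
rewrite leqNgt => /negP[]; rewrite (bigD1 j) //= [X in (_ < X)%N](bigD1 j) //=.
rewrite -addSn leq_add //.
  rewrite -/D -(prednK D_gt0) ltnS; apply/bigmax_leqP => i _.
  by rewrite mxE eqxx -!subn1 leq_sub2r.
apply: leq_sum => l lj; apply/bigmax_leqP => i _; rewrite mxE (negPf lj).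
exact: leq_col_deg.
Qed.

(** Evaluation keeps the columns of [M] independent, so the dimension is their number. *)
Lemma dim_ker_at a b r (Q : 'M[{poly F}]_(a, b)) (M : 'M[{poly F}]_(b, r)) lam :
  right_minimal_basis Q M -> \dim (ker_at M lam) = (b - \rank (frac_mx Q))%N.
Proof.
move=> minM; rewrite dim_span_cols free_cols_rank.
  by case: minM => /basis_kervP[].
by move=> c; apply: minimal_basis_eval_inj minM.
Qed.

Lemma ker_at_sub a b r (Q : 'M[{poly F}]_(a, b)) (M : 'M[{poly F}]_(b, r)) lam :
  right_minimal_basis Q M -> (ker_at M lam <= kerv (eval_mx Q lam))%VS.
Proof.
move=> [/basis_kervP[QM0 _ _] _]; apply/subvP=> v /span_colsP[c ->].
rewrite mem_kerv mulmxA -eval_mxM; suff -> : Q *m M = 0.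
  by rewrite eval_mxE map_mx0 mul0mx.
by apply: frac_mx_inj; rewrite /frac_mx map_mxM map_mx0.
Qed.

End MinimalBases.

Lemma scalemx_injl (R : idomainType) m n (c : R) :
  c != 0 -> injective ( *:%R c : 'M[R]_(m, n) -> 'M[R]_(m, n)).
Proof.
move=> c0 A B /matrixP eqAB; apply/matrixP=> i j; apply: (mulfI c0).
by have := eqAB i j; rewrite !mxE.
Qed.

(** * Finite-dimensional spaces of polynomial rows *)

Section Dimension.
Variable F : fieldType.

Definition cst_mx m n (A : 'M[F]_(m, n)) : 'M[{poly F}]_(m, n) := map_mx polyC A.

(** A basis over [F], hence with constant coefficients only. The space is a predicate because it
    sits in the infinite-dimensional space of all polynomial rows. *)
Definition basis_rows m p (S : 'rV[{poly F}]_m -> Prop) (T : 'M[{poly F}]_(p, m)) :=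
  (forall u : 'rV[F]_p, cst_mx u *m T = 0 -> u = 0) /\
  (forall a, S a <-> exists u : 'rV[F]_p, a = cst_mx u *m T).

Definition has_dim m (S : 'rV[{poly F}]_m -> Prop) p :=
  exists T : 'M[{poly F}]_(p, m), basis_rows S T.

Definition lin_closed m (S : 'rV[{poly F}]_m -> Prop) :=
  S 0 /\ forall c a b, S a -> S b -> S (c%:P *: a + b).

Lemma lin_closed_mul m p (S : 'rV[{poly F}]_m -> Prop) (T : 'M[{poly F}]_(p, m))
    (u : 'rV[F]_p) :
  lin_closed S -> (forall i, S (row i T)) -> S (cst_mx u *m T).
Proof.
move=> [S0 Sl] ST; rewrite mulmx_sum_row; elim/big_rec: _ => // i a _ Sa.
by rewrite mxE; apply: Sl.
Qed.

Lemma lin_closedB m (S : 'rV[{poly F}]_m -> Prop) a b :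
  lin_closed S -> S a -> S b -> S (a - b).
Proof. by move=> [_ Sl] Sa Sb; rewrite addrC -scaleN1r -polyCN; apply: Sl. Qed.

Lemma map_scalar_mul m p (eps : {scalar {poly F}}) (T : 'M[{poly F}]_(p, m))
    (u : 'rV[F]_p) :
  map_mx eps (cst_mx u *m T) = u *m map_mx eps T.
Proof.
apply/rowP=> j; rewrite !mxE linear_sum; apply: eq_bigr => i _.
by rewrite !mxE mul_polyC linearZ.
Qed.

(** Rank-nullity for [eps] applied entrywise to [S]: the kernel is [f *: S'], the image is the left
    kernel of [Q]. General [f] and [eps] cover finite roots (['X - t%:P] and evaluation) as well as
    infinite ones ([1] and a top coefficient). *)
Lemma has_dim_extend m n p (S S' : 'rV[{poly F}]_m -> Prop) (f : {poly F})
    (eps : {scalar {poly F}}) (Q : 'M[F]_(m, n)) :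
  f != 0 -> lin_closed S ->
  (forall a, S' a -> S (f *: a) /\ map_mx eps (f *: a) = 0) ->
  (forall a, S a -> map_mx eps a = 0 -> exists2 a', a = f *: a' & S' a') ->
  (forall a, S a -> map_mx eps a *m Q = 0) ->
  (forall c, c *m Q = 0 -> exists2 a, S a & map_mx eps a = c) ->
  has_dim S' p -> has_dim S (p + (m - \rank Q)).
Proof.
move=> f0 Slin S'S SS' epsQ lift [T [freeT spanT]]; rewrite -mxrank_ker.
pose Z := row_base (kermx Q).
have ZQ i : row i Z *m Q = 0.
  apply/sub_kermxP; apply: (submx_trans (row_sub i Z)).
  by rewrite eq_row_base.
have [l Sl epsl] := fin_all_exists2 (fun i => lift _ (ZQ i)).
pose E := \matrix_i l i.
have rowE i : row i E = l i by rewrite rowK.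
have epsE : map_mx eps E = Z.
  by apply/row_matrixP=> i; rewrite -map_row rowE epsl.
have SE u : S (cst_mx u *m E).
  by apply: lin_closed_mul => // i; rewrite rowE.
have mulcol u1 u2 : cst_mx (row_mx u1 u2) *m col_mx (f *: T) E
    = f *: (cst_mx u1 *m T) + cst_mx u2 *m E.
  by rewrite /cst_mx map_row_mx mul_row_col scalemxAr.
have ST u : S (f *: (cst_mx u *m T)) /\ map_mx eps (f *: (cst_mx u *m T)) = 0.
  by apply: S'S; apply/spanT; exists u.
have epsD a b : map_mx eps (a + b) = map_mx eps a + map_mx eps b :> 'rV_m.
  by rewrite map_mxD.
(* A basis of the kernel of [eps], followed by lifts of a basis of its image. *)
exists (col_mx (f *: T) E); split=> [u|a].
  rewrite -(hsubmxK u) mulcol => u0.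
  have := congr1 (map_mx eps) u0.
  rewrite epsD (proj2 (ST _)) add0r map_scalar_mul epsE map_mx0 => uZ.
  have u20 : rsubmx u = 0.
    apply: (row_free_inj (row_base_free (kermx Q))); rewrite -/Z mul0mx; exact: uZ.
  move: u0; rewrite u20 /cst_mx map_mx0 mul0mx addr0.
  rewrite -(scaler0 _ f) => /(scalemx_injl f0)/freeT->.
  by rewrite row_mx0.
split=> [Sa|[u ->]]; last first.
  rewrite -(hsubmxK u) mulcol -[f *: _]scale1r -polyC1.
  by apply: (proj2 Slin) => //; case: (ST (lsubmx u)).
have /sub_kermxP := epsQ a Sa.
rewrite -[X in (_ <= X)%MS]/(kermx Q).
rewrite -(eq_row_base (kermx Q)) -/Z => /submxP[u2 epsa].
have [a' a'E Sa'] : exists2 a', a - cst_mx u2 *m E = f *: a' & S' a'.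
  apply: SS'; first exact: lin_closedB.
  by rewrite map_mxB map_scalar_mul epsE epsa subrr.
have /spanT[u1 u1E] := Sa'; exists (row_mx u1 u2).
by rewrite mulcol -u1E -a'E subrK.
Qed.

Lemma has_dim_const0 m : @has_dim m (fun a => a = 0) 0.
Proof.
exists 0; split=> [u _|a]; first by rewrite [u]thinmx0.
by split=> [->|[u ->]]; [exists 0|]; rewrite mulmx0.
Qed.

End Dimension.

(** * Syzygies modulo [w]: adding a finite root *)

Section Syzygies.
Variables (F : fieldType) (m n : nat) (k : nat) (P : 'M[{poly F}]_(m, n)).
Hypothesis gradeP : grade_le k P.
Implicit Types (w : {poly F}) (d : nat) (a : 'rV[{poly F}]_m).

(** For [w] of degree exactly [d], the bound on [b] follows from the one on [a]. For smaller degrees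
    it is a genuine condition, which accounts for the roots of [w] at infinity. *)
Definition left_syzygy d w a :=
  (forall j, (size (a 0%R j) <= d)%N) /\
  exists2 b : 'rV[{poly F}]_n, (forall j, (size (b 0%R j) <= k)%N)
    & a *m P = w *: b.

Lemma left_syzygy_lin d w : lin_closed (left_syzygy d w).
Proof.
have szD e (c : F) (p q : {poly F}) : (size p <= e -> size q <= e ->
    size (c%:P * p + q)%R <= e)%N.
  move=> sp sq; apply: (leq_trans (size_polyD _ _)); rewrite geq_max sq andbT.
  by rewrite mul_polyC (leq_trans (size_scale_leq _ _)).
split=> [|c a1 a2 [sa1 [b1 sb1 ab1]] [sa2 [b2 sb2 ab2]]].
  split=> [j|]; first by rewrite mxE size_poly0.
  by exists 0 => [j|]; rewrite ?mxE ?size_poly0 // mul0mx scaler0.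
split=> [j|]; first by rewrite !mxE szD.
exists (c%:P *: b1 + b2) => [j|]; first by rewrite !mxE szD.
by rewrite mulmxDl -scalemxAl ab1 ab2 scalerDr !scalerA mulrC.
Qed.

Lemma left_syzygy0 w : w != 0 -> has_dim (left_syzygy 0 w) 0.
Proof.
move=> w0; have [T [freeT spanT]] := has_dim_const0 F m.
exists T; split=> // a.
apply: (iff_trans _ (spanT a)); split=> [[sa _]|->].
  apply/rowP=> j; rewrite mxE; apply/eqP.
  by rewrite -size_poly_eq0 -leqn0.
exact: (proj1 (left_syzygy_lin 0 w)).
Qed.

Lemma size_row_mul (a : 'rV[{poly F}]_m) d j :
  (forall i, (size (a 0%R i) <= d)%N) -> (size ((a *m P)%R 0%R j) <= d + k)%N.
Proof.
move=> sa; rewrite mxE; apply: (leq_trans (size_sum _ _ _)).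
apply/bigmax_leqP => i _; apply: (leq_trans (size_polyMleq _ _)).
have := leq_add (sa i) (gradeP i j); rewrite addnS.
by case: (_ + _)%N => //= l; rewrite ltnS.
Qed.

Lemma size_quot w b (c : {poly F}) d : w != 0 ->
  c = w * b -> (size c < size w + d)%N -> (size b <= d)%N.
Proof.
move=> w0 ->; have [->|b0] := eqVneq b 0; first by rewrite size_poly0.
rewrite size_mul // -(prednK (_ : 0 < size w)%N) ?size_poly_gt0 //=.
by rewrite addSn ltnS /= leq_add2l.
Qed.

(** Multiplication by ['X - t%:P] identifies the old space with the rows of the new one that vanish
    at [t]. Values at [t] lie in the left kernel of [P(t)], and the lifting hypothesis says that
    they fill it. *)
Lemma has_dim_root d w t p : w != 0 ->
  (forall c, c *m eval_mx P t = 0 ->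
    exists2 a, left_syzygy d.+1 (('X - t%:P) * w) a & eval_mx a t = c) ->
  has_dim (left_syzygy d w) p ->
  has_dim (left_syzygy d.+1 (('X - t%:P) * w)) (p + (m - \rank (eval_mx P t))).
Proof.
move=> w0 lift; have Xt0 : 'X - t%:P != 0 by rewrite polyXsubC_eq0.
have Xtt : ('X - t%:P).[t] = 0 by rewrite hornerXsubC subrr.
have szXt (q : {poly F}) : size (('X - t%:P) * q) = if q == 0 then 0 else (size q).+1.
  have [->|q0] := eqVneq q 0; first by rewrite mulr0 size_poly0.
  by rewrite size_monicM ?monicXsubC // size_XsubC.
apply: (@has_dim_extend _ _ _ _ _ _ ('X - t%:P) (horner_eval t)) => //.
- exact: left_syzygy_lin.
- move=> a [sa [b sb ab]]; split; last first.
    by apply/rowP=> j; rewrite !mxE /= /horner_eval hornerM Xtt mul0r.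
  split=> [j|]; first by rewrite mxE szXt; case: ifP => // _; rewrite ltnS.
  by exists b; rewrite // -scalemxAl ab scalerA.
- move=> a [sa [b sb ab]] /rowP at0.
  pose a' : 'rV_m := \row_j (a 0 j %/ ('X - t%:P)).
  have aE : a = ('X - t%:P) *: a'.
    apply/rowP=> j; rewrite !mxE mulrC; apply/eqP.
    rewrite -dvdp_eq dvdp_XsubCl /root; apply/eqP.
    by have := at0 j; rewrite !mxE.
  exists a' => //; split=> [j|].
    have := sa j; rewrite {1}aE mxE szXt; case: eqP => [->|_].
      by rewrite size_poly0.
    by rewrite ltnS.
  exists b => //; apply: (scalemx_injl Xt0).
  by rewrite scalemxAl -aE ab scalerA.
- move=> a [sa [b sb ab]]; rewrite -[map_mx _ a]/(eval_mx a t) -eval_mxM ab.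
  by apply/rowP=> j; rewrite !mxE !hornerM Xtt !mul0r.
Qed.

Lemma has_dim_good_root d w t p : w != 0 -> (size w <= d.+1)%N ->
  \rank (eval_mx P t) = \rank (frac_mx P) ->
  has_dim (left_syzygy d w) p ->
  has_dim (left_syzygy d.+1 (('X - t%:P) * w)) (p + (m - \rank (frac_mx P))).
Proof.
move=> w0 sw rkP; rewrite -rkP; apply: has_dim_root => // c cP0.
have [a0 a0P a0t] := left_kernel_lift rkP cP0.
set W := ('X - t%:P) * w.
have W0 : W != 0 by rewrite mulf_neq0 ?polyXsubC_eq0.
have sW : (size W <= d.+2)%N.
  by rewrite size_monicM ?monicXsubC // size_XsubC ltnS.
(* The remainder [a] of [a0] modulo [W] keeps the value at the root [t] of [W], has the required
   degree, and [a *m P] is still a multiple of [W] because [a0 *m P = 0]. *)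
pose q : 'rV_m := \row_j (a0 0 j %/ W); pose a : 'rV_m := \row_j (a0 0 j %% W).
have aE : a0 = W *: q + a.
  by apply/rowP=> j; rewrite !mxE mulrC -divp_eq.
have saW j : (size (a 0%R j) < size W)%N by rewrite mxE ltn_modp.
exists a; last first.
  rewrite -a0t aE; apply/rowP=> j.
  by rewrite !mxE !hornerE subrr !mul0r add0r.
have sa j : (size (a 0%R j) <= d.+1)%N by rewrite -ltnS (leq_trans (saW j)).
split=> //; have abE : a *m P = W *: - (q *m P).
  apply/eqP; rewrite scalerN -addr_eq0 addrC scalemxAl -mulmxDl -aE.
  by rewrite a0P.
exists (- (q *m P)) => // j.
apply: (size_quot (w := W) (c := (a *m P) 0 j)) => //.
  by rewrite abE mxE.
apply: (@leq_ltn_trans ((size W).-1 + k)).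
  by apply: size_row_mul => i; have := saW i; case: (size W).
by rewrite ltn_add2r prednK ?size_poly_gt0.
Qed.

(** For a single root, constant rows serve as lifts, so [t] may be an eigenvalue of [P], as [lam]
    may be. *)
Lemma has_dim_first_root c t : c != 0 ->
  has_dim (left_syzygy 1 (('X - t%:P) * c%:P)) (m - \rank (eval_mx P t)).
Proof.
move=> c0; have cP0 : c%:P != 0 :> {poly F} by rewrite polyC_eq0.
rewrite -[(m - _)%N]add0n; apply: has_dim_root => //; last exact: left_syzygy0.
move=> u uP0; exists (cst_mx u); last first.
  by apply/rowP=> j; rewrite !mxE hornerC.
split=> [j|]; first by rewrite mxE size_polyC leq_b1.
set W := _ * _; have W0 : W != 0 by rewrite mulf_neq0 ?polyXsubC_eq0.
pose b : 'rV_n := \row_j ((cst_mx u *m P) 0 j %/ W).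
have bE : cst_mx u *m P = W *: b.
  apply/rowP=> j; rewrite [RHS]mxE [b 0 j]mxE mulrC; apply/eqP; rewrite -dvdp_eq.
  rewrite /W mulrC mul_polyC dvdpZl // dvdp_XsubCl /root.
  have /rowP/(_ j) : eval_mx (cst_mx u *m P) t = 0.
    rewrite eval_mxM; rewrite -[RHS]uP0; congr (_ *m _).
    by apply/rowP=> i; rewrite !mxE hornerC.
  by rewrite [LHS]mxE [RHS]mxE => ->.
exists b => // j; apply: (size_quot (w := W) (c := (cst_mx u *m P) 0 j)) => //.
  by rewrite bE mxE.
apply: (@leq_ltn_trans (1 + k)).
  by apply: size_row_mul => i; rewrite mxE size_polyC leq_b1.
by rewrite ltn_add2r size_monicM ?monicXsubC // size_XsubC size_polyC c0.
Qed.

End Syzygies.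

(** * Reversal of polynomials of a given grade *)

Section Reversal.
Variable F : fieldType.
Implicit Types (p q : {poly F}).

Definition rev_poly k p : {poly F} := \poly_(i < k.+1) p`_(k - i).

Lemma coef_rev_poly k p i :
  (rev_poly k p)`_i = if (i <= k)%N then p`_(k - i) else 0.
Proof. by rewrite coef_poly ltnS. Qed.

Lemma size_rev_poly k p : (size (rev_poly k p) <= k.+1)%N.
Proof. exact: size_poly. Qed.

Lemma rev_polyE k p : rev_poly k p = \sum_(i < k.+1) p`_i *: 'X^(k - i).
Proof.
rewrite /rev_poly poly_def (reindex_inj rev_ord_inj) /=; apply: eq_bigr => i _.
by rewrite subSS subKn // -ltnS.
Qed.

Lemma rev_polyK k p : (size p <= k.+1)%N -> rev_poly k (rev_poly k p) = p.
Proof.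
move=> sp; apply/polyP=> i; rewrite coef_rev_poly.
have [ik|ki] := leqP i k; first by rewrite coef_rev_poly leq_subr subKn.
by rewrite nth_default // (leq_trans sp).
Qed.

Lemma rev_polyZXn k c i : (i <= k)%N -> rev_poly k (c *: 'X^i) = c *: 'X^(k - i).
Proof.
move=> ik; apply/polyP=> j; rewrite coef_rev_poly !coefZ !coefXn.
have [jk|kj] := leqP j k.
  congr (_ * (nat_of_bool _)%:R); apply/eqP/eqP => [<-|->]; first by rewrite subKn.
  by rewrite subKn.
have /negPf -> : j != (k - i)%N by rewrite gtn_eqF // (leq_ltn_trans (leq_subr _ _)).
by rewrite mulr0.
Qed.

Lemma rev_poly_sum k I (r : seq I) (f : I -> {poly F}) :
  rev_poly k (\sum_(i <- r) f i) = \sum_(i <- r) rev_poly k (f i).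
Proof.
apply/polyP=> i; rewrite coef_rev_poly !coef_sum.
have [ik|ki] := leqP i k.
  by apply: eq_bigr => j _; rewrite coef_rev_poly ik.
by rewrite big1 // => j _; rewrite coef_rev_poly leqNgt ki.
Qed.

(** This is [z^(e+k) p(1/z) q(1/z)], checked on monomials. *)
Lemma rev_polyM e k p q :
  (size p <= e.+1)%N -> (size q <= k.+1)%N ->
  rev_poly (e + k) (p * q) = rev_poly e p * rev_poly k q.
Proof.
move=> sp sq; rewrite [rev_poly e p]rev_polyE [rev_poly k q]rev_polyE.
have polyE l (s : {poly F}) : (size s <= l.+1)%N -> s = \sum_(i < l.+1) s`_i *: 'X^i.
  by move=> ss; rewrite -poly_def; apply/polyP=> i; rewrite coef_poly; case: ltnP => // li;
     rewrite nth_default // (leq_trans ss).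
rewrite {1}(polyE _ _ sp) {1}(polyE _ _ sq) mulr_suml rev_poly_sum mulr_suml.
apply: eq_bigr => i _; rewrite !mulr_sumr rev_poly_sum; apply: eq_bigr => j _.
have ie : (i <= e)%N by rewrite -ltnS.
have jk : (j <= k)%N by rewrite -ltnS.
have XX a b : p`_i *: 'X^a * (q`_j *: 'X^b) = (p`_i * q`_j) *: 'X^(a + b).
  by rewrite exprD -scalerAl -scalerAr scalerA.
rewrite !XX rev_polyZXn ?leq_add //; congr (_ *: 'X^_).
by rewrite subnDA -addnBAC // -addnBA.
Qed.

Lemma horner_rev_poly k p t : (size p <= k.+1)%N -> t != 0 ->
  (rev_poly k p).[t] = t ^+ k * p.[t^-1].
Proof.
move=> sp t0; rewrite rev_polyE horner_sum (horner_coef_wide _ sp) mulr_sumr.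
apply: eq_bigr => i _; have ik : (i <= k)%N by rewrite -ltnS.
rewrite hornerZ hornerXn exprB ?unitfE //.
by rewrite exprVn mulrCA.
Qed.

Lemma eval_rev_mx k m n (P : 'M[{poly F}]_(m, n)) t : grade_le k P -> t != 0 ->
  eval_mx (rev_mx k P) t = t ^+ k *: eval_mx P t^-1.
Proof.
by move=> gP t0; apply/matrixP=> i j; rewrite !mxE -horner_rev_poly.
Qed.

Lemma grade_rev_mx k m n (P : 'M[{poly F}]_(m, n)) : grade_le k (rev_mx k P).
Proof. by move=> i j; rewrite mxE; apply: size_rev_poly. Qed.

Lemma rev_mxK k m n (P : 'M[{poly F}]_(m, n)) :
  grade_le k P -> rev_mx k (rev_mx k P) = P.
Proof. by move=> gP; apply/matrixP=> i j; rewrite !mxE; apply: rev_polyK. Qed.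

End Reversal.

(** * Generic points over a closed field *)

Section ClosedField.
Variable F : closedFieldType.

Lemma exists_generic m n (Q : 'M[{poly F}]_(m, n)) (h : {poly F}) : h != 0 ->
  exists2 t, h.[t] != 0 & \rank (eval_mx Q t) = \rank (frac_mx Q).
Proof.
move=> h0; have [g g0 rkQ] := rank_eval_generic Q.
have /closed_nonrootP[t] : h * g != 0 by rewrite mulf_neq0.
rewrite /root hornerM mulf_eq0 negb_or => /andP[ht gt].
by exists t; last exact: rkQ.
Qed.

(** At a generic nonzero [t], the reversal is a nonzero multiple of [P(1/t)]. Reversal being an
    involution, this inequality will give equality. *)
Lemma rank_frac_rev_le k m n (P : 'M[{poly F}]_(m, n)) : grade_le k P ->
  (\rank (frac_mx (rev_mx k P)) <= \rank (frac_mx P))%N.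
Proof.
move=> gP; have [t] := exists_generic (rev_mx k P) (negbT (polyX_eq0 F)).
rewrite hornerX => t0 <-; rewrite eval_rev_mx // mxrank_scale_nz ?expf_neq0 //.
exact: rank_eval_le.
Qed.

Lemma rank_frac_rev k m n (P : 'M[{poly F}]_(m, n)) : grade_le k P ->
  \rank (frac_mx (rev_mx k P)) = \rank (frac_mx P).
Proof.
move=> gP; apply/eqP; rewrite eqn_leq rank_frac_rev_le //=.
by rewrite -{1}(rev_mxK gP) rank_frac_rev_le //; apply: grade_rev_mx.
Qed.

End ClosedField.

(** * Syzygies modulo [w]: adding a root at infinity *)

Section Infinity.
Variables (F : fieldType) (m n k : nat) (P : 'M[{poly F}]_(m, n)).
Hypothesis gradeP : grade_le k P.

(** Compare the constant coefficients in the multiplicativity of reversal. *)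
Lemma coefM_top (p q : {poly F}) a b :
  (size p <= a.+1)%N -> (size q <= b.+1)%N -> (p * q)`_(a + b) = p`_a * q`_b.
Proof.
move=> sp sq; have := rev_polyM sp sq => /(congr1 (fun r : {poly F} => r`_0)).
by rewrite coef0M !coef_rev_poly /= !subn0.
Qed.

Lemma coef0_eval_rev c (j : 'I_n) (i : 'I_m) :
  c * eval_mx (rev_mx k P) 0 i j = c * (P i j)`_k.
Proof. by rewrite !mxE horner_coef0 coef_poly /= subn0. Qed.

(* A polynomial [a1] with [a1 *m rev P = 0] is a kernel vector near infinity;
   reversing its first coefficients gives [top], and [top *m P] has small
   degree because the high order terms of [a1 *m rev P] vanish. *)
Lemma has_dim_infty d (w : {poly F}) p : w != 0 -> (size w <= d.+1)%N ->
  \rank (eval_mx (rev_mx k P) 0) = \rank (frac_mx (rev_mx k P)) ->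
  has_dim (left_syzygy k P d w) p ->
  has_dim (left_syzygy k P d.+1 w) (p + (m - \rank (frac_mx (rev_mx k P)))).
Proof.
move=> w0 sw rkP; rewrite -rkP.
(* The polynomial [w] stays and the degree bound grows: taking the new top coefficient, [coefp d],
   replaces evaluation. *)
apply: (@has_dim_extend _ _ _ _ _ _ 1 (coefp d)); rewrite ?oner_neq0 //.
- exact: left_syzygy_lin.
- move=> a [sa ab]; rewrite scale1r; split.
    by split=> // j; apply: leqW.
  by apply/rowP=> j; rewrite !mxE /= nth_default.
- move=> a [sa ab] /rowP ad; exists a; rewrite ?scale1r //; split=> // j.
  have := ad j; rewrite !mxE /= => adj; apply/leq_sizeP => l dl.
  have [<-//|ld] := eqVneq d l.
  by rewrite nth_default // (leq_trans (sa j)) // ltn_neqAle ld.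
- move=> a [sa [b sb ab]]; apply/rowP=> j; rewrite !mxE.
  (* The product [w *: b] has degree below [d + k], so this coefficient vanishes; on the left it is
     the product of the top coefficients. *)
  transitivity ((a *m P) 0 j)`_(d + k).
    rewrite mxE coef_sum; apply: eq_bigr => i _.
    by rewrite coef0_eval_rev mxE coefM_top.
  rewrite ab mxE nth_default //; apply: (leq_trans (size_polyMleq _ _)).
  by have := leq_add sw (sb j); rewrite addSn; case: (_ + _)%N.
move=> c cP0; have [a1 a1P a10] := left_kernel_lift rkP cP0.
(* This is [d] minus the degree of [w], so [w *: top] has degree at most [d], with coefficient at
   [d] equal to [lead_coef w] times that of [top] at [e]. *)
pose e := (d.+1 - size w)%N.
pose top : 'rV[{poly F}]_m := \row_j rev_poly e (take_poly e.+1 (a1 0 j)).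
pose a := (lead_coef w)^-1%:P *: (w *: top).
pose b := (lead_coef w)^-1%:P *: (top *m P).
have lw0 : lead_coef w != 0 by rewrite lead_coef_eq0.
have swE : (size w).-1.+1 = size w by rewrite prednK ?size_poly_gt0.
have sw1 : (size w <= (size w).-1.+1)%N by rewrite swE.
have dE : d = ((size w).-1 + e)%N.
  by rewrite /e -swE subSS subnKC // -ltnS swE.
have stop i : (size (top 0%R i) <= e.+1)%N by rewrite mxE size_rev_poly.
exists a; last first.
  apply/rowP=> j; rewrite !mxE /= coefCM dE coefM_top ?size_rev_poly //.
  rewrite -[w`__]/(lead_coef w) mulKf // coef_rev_poly leqnn subnn.
  rewrite coef_take_poly /= -a10 mxE.
  by rewrite horner_coef0.
split=> [j|].
  rewrite !mxE mul_polyC; apply: leq_trans (size_scale_leq _ _) _.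
  apply: leq_trans (size_polyMleq _ _) _.
  have := stop j; rewrite mxE dE -swE addSn /= => sj.
  by rewrite -addnS leq_add2l.
exists b; last by rewrite /a /b -!scalemxAl !scalerA mulrC.
move=> j; rewrite mxE mul_polyC; apply: leq_trans (size_scale_leq _ _) _.
apply/leq_sizeP => l kl.
pose A := \row_i take_poly e.+1 (a1 0 i).
have -> : (top *m P) 0 j = rev_poly (e + k) ((A *m rev_mx k P) 0 j).
  rewrite !mxE rev_poly_sum; apply: eq_bigr => i _; rewrite !mxE rev_polyM.
  - by rewrite -[X in _ = _ * rev_poly k X]/(rev_poly k _) rev_polyK.
  - exact: size_take_poly.
  exact: size_rev_poly.
rewrite coef_rev_poly; case: leqP => // lek.
(* Truncation disturbs [a1 *m rev_mx k P = 0] only from degree [e.+1] on, while the index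
   [e + k - l] is at most [e]. *)
have -> : A = a1 - 'X^(e.+1) *: \row_i drop_poly e.+1 (a1 0 i).
  apply/rowP=> i; rewrite !mxE mulrC; apply/eqP.
  by rewrite eq_sym subr_eq poly_take_drop.
rewrite mulmxBl a1P sub0r -scalemxAl !mxE coefN coefXnM.
by rewrite (_ : (_ < _)%N) ?oppr0 // ltnS leq_subLR addnC leq_add2r.
Qed.

End Infinity.

(** * Dimension of the syzygy space *)

Section SyzygyDimension.
Variables (F : closedFieldType) (m n k : nat) (P : 'M[{poly F}]_(m, n)).
Hypothesis gradeP : grade_le k P.
Local Notation rkP := (\rank (frac_mx P)).

(** The point [lam], where the rank may drop, comes first since its lifts are constant; the points
    of [ts], where the rank is full, follow. *)
Lemma has_dim_finite_roots c lam (ts : seq F) : c != 0 ->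
  {in ts, forall t, \rank (eval_mx P t) = rkP} ->
  has_dim (left_syzygy k P (size ts).+1
             (\prod_(t <- ts) ('X - t%:P) * (('X - lam%:P) * c%:P)))
    (m - \rank (eval_mx P lam) + size ts * (m - rkP)).
Proof.
move=> c0; elim: ts => [|t ts IHts] good.
  by rewrite big_nil mul1r mul0n addn0; apply: has_dim_first_root.
rewrite big_cons -mulrA /= mulSn addnCA addnC.
have prod0 : \prod_(t <- ts) ('X - t%:P) != 0.
  exact/monic_neq0/monic_prod_XsubC.
have w0 : \prod_(t <- ts) ('X - t%:P) * (('X - lam%:P) * c%:P) != 0.
  by rewrite !mulf_neq0 ?polyXsubC_eq0 ?polyC_eq0.
apply: has_dim_good_root => //.
- rewrite mulrA mulrC mul_polyC size_scale //.
  by rewrite size_Mmonic ?monicXsubC // size_XsubC size_prod_XsubC addn2.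
- by apply: good; rewrite mem_head.
by apply: IHts => s sts; apply: good; rewrite in_cons sts orbT.
Qed.

Lemma has_dim_infinite_roots d e (w : {poly F}) p : w != 0 -> (size w <= d.+1)%N ->
  (0 < e -> \rank (eval_mx (rev_mx k P) 0) = \rank (frac_mx (rev_mx k P)))%N ->
  has_dim (left_syzygy k P d w) p ->
  has_dim (left_syzygy k P (d + e) w) (p + e * (m - rkP)).
Proof.
move=> w0 sw + dim0; elim: e => [|e IHe] rk_oo.
  by rewrite mul0n !addn0.
rewrite addnS mulSn addnCA [X in has_dim _ X]addnC -(rank_frac_rev gradeP).
apply: has_dim_infty => //; first by rewrite (leq_trans sw) // ltnS leq_addr.
  exact: rk_oo.
by rewrite (rank_frac_rev gradeP); apply: IHe => _; apply: rk_oo.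
Qed.

Lemma good_point mu (v : {poly F}) :
  (forall mu, ~~ (eigenvalue_at k P mu && root_at k.-1 v mu)) ->
  root_at k.-1 v mu ->
  if mu is Some t then \rank (eval_mx P t) = rkP
  else \rank (eval_mx (rev_mx k P) 0) = \rank (frac_mx (rev_mx k P)).
Proof.
move=> disj vmu; have := disj mu; rewrite vmu andbT.
by case: mu {vmu} => [t|] /=; rewrite /fin_eigenvalue -leqNgt => le_rk; apply/eqP;
  rewrite eqn_leq le_rk rank_eval_le.
Qed.

Lemma has_dim_syzygy lam (v : {poly F}) : (0 < k)%N -> ansatz k.-1 v ->
  (forall mu, ~~ (eigenvalue_at k P mu && root_at k.-1 v mu)) ->
  has_dim (left_syzygy k P k (('X - lam%:P) * v))
    (m - \rank (eval_mx P lam) + k.-1 * (m - rkP)).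
Proof.
move=> k_gt0 /andP[v0]; rewrite prednK // => sv disj.
have [ts vE] := closed_field_poly_normal v.
have lv0 : lead_coef v != 0 by rewrite lead_coef_eq0.
have svE : (size v).-1 = size ts.
  by rewrite vE size_scale // size_prod_XsubC.
have wE : ('X - lam%:P) * v
    = \prod_(t <- ts) ('X - t%:P) * (('X - lam%:P) * (lead_coef v)%:P).
  by rewrite {1}vE -mul_polyC [RHS]mulrC mulrA.
have w0 : ('X - lam%:P) * v != 0 by rewrite mulf_neq0 ?polyXsubC_eq0.
have ts_le : (size ts <= k.-1)%N by rewrite -svE -!subn1 leq_sub2r.
have good : {in ts, forall t, \rank (eval_mx P t) = rkP}.
  move=> t tts; apply: (good_point (mu := Some t) disj).
  by rewrite /= vE rootZ // root_prod_XsubC.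
have := has_dim_finite_roots lam lv0 good; rewrite -wE => dim1.
(* In grade [k.-1], the roots of [v] that are not in [ts] are at infinity, [k.-1 - size ts] in
   number. *)
have := @has_dim_infinite_roots (size ts).+1 (k.-1 - size ts) _ _ w0 _ _ dim1.
rewrite addSn subnKC // prednK // -addnA -mulnDl subnKC //; apply.
  rewrite size_monicM ?monicXsubC // size_XsubC -svE prednK ?size_poly_gt0 //.
by rewrite subn_gt0 -svE => v_oo; apply: (good_point (mu := None) disj).
Qed.

End SyzygyDimension.

(** * Coordinates on spaces of polynomial rows *)

Section Coordinates.
Variable F : fieldType.

(** The coordinates of the rows of [A] in the basis [E] form a square matrix with zero left kernel,
    hence an invertible one. *)
Lemma basis_rows_square N m (T : 'rV[{poly F}]_m -> Prop)
    (E A : 'M[{poly F}]_(N, m)) :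
  basis_rows T E -> (forall u : 'rV[F]_N, cst_mx u *m A = 0 -> u = 0) ->
  (forall i, T (row i A)) -> basis_rows T A.
Proof.
move=> [freeE spanT] freeA TA.
have [x xE] := fin_all_exists (fun i => proj1 (spanT _) (TA i)).
pose X := \matrix_i x i.
have XE u : cst_mx u *m A = cst_mx (u *m X) *m E.
  rewrite /cst_mx map_mxM -mulmxA; congr (_ *m _); apply/row_matrixP=> i.
  by rewrite row_mul -map_row rowK xE.
have uX : X \in unitmx.
  rewrite -row_free_unit -kermx_eq0; apply/eqP/row_matrixP=> i; rewrite row0.
  apply: freeA; rewrite XE -row_mul mulmx_ker row0.
  by rewrite /cst_mx map_mx0 mul0mx.
split=> // a; split=> [/spanT[y ->]|[u ->]].
  by exists (y *m invmx X); rewrite XE mulmxKV.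
by apply/spanT; exists (u *m X); rewrite XE.
Qed.

(** The injection [u |-> cst_mx u *m A] maps the left kernel of [B] onto [S]. *)
Lemma has_dim_kernel N m p q (S T : 'rV[{poly F}]_m -> Prop)
    (A : 'M[{poly F}]_(N, m)) (B : 'M[F]_(N, q)) :
  basis_rows T A -> (forall a, S a -> T a) -> has_dim S p ->
  (forall u : 'rV[F]_N, u *m B = 0 <-> S (cst_mx u *m A)) ->
  p = (N - \rank B)%N.
Proof.
move=> [freeA spanA] sST [E [freeE spanE]] kerB.
have rowS i : S (row i E).
  apply/spanE; exists (delta_mx 0 i).
  by rewrite /cst_mx map_delta_mx -rowE.
have [x xA] := fin_all_exists (fun i => proj1 (spanA _) (sST _ (rowS i))).
pose X := \matrix_i x i.
have XA u : cst_mx u *m E = cst_mx (u *m X) *m A.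
  rewrite /cst_mx map_mxM -mulmxA; congr (_ *m _); apply/row_matrixP=> i.
  by rewrite row_mul -map_row rowK xA.
have cst_mxB (u1 u2 : 'rV[F]_N) : cst_mx (u1 - u2) = cst_mx u1 - cst_mx u2.
  by rewrite /cst_mx map_mxB.
have freeX : row_free X.
  rewrite -kermx_eq0; apply/eqP/row_matrixP=> i; rewrite row0.
  apply: freeE; rewrite XA -row_mul mulmx_ker row0.
  by rewrite /cst_mx map_mx0 mul0mx.
rewrite -mxrank_ker -(eqP freeX); apply/eqP; rewrite eqn_leq.
apply/andP; split; apply: mxrankS.
  apply/sub_kermxP/row_matrixP=> i; rewrite row_mul rowK row0.
  by apply/kerB; rewrite -xA.
apply/row_subP=> i; have : row i (kermx B) *m B = 0.
  by rewrite -row_mul mulmx_ker row0.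
move=> /kerB/spanE[y]; rewrite XA => /eqP; rewrite -subr_eq0 -mulmxBl -cst_mxB.
move=> /eqP/freeA/eqP; rewrite subr_eq0 => /eqP->; exact: submxMl.
Qed.

(** The Kronecker product of the column of the [t i] with the identity: multiplied by [u] on the
    left, it combines the blocks of [u] with coefficients [t i]. *)
Definition block_rows k m (t : nat -> {poly F}) : 'M[{poly F}]_(k * m, m) :=
  \matrix_(s, b) (t (mxtens_unindex s).1 *+ ((mxtens_unindex s).2 == b)).

Lemma sum_mxtens (V : nmodType) k m (f : 'I_(k * m) -> V) :
  \sum_s f s = \sum_i \sum_a f (mxtens_index (i, a)).
Proof.
rewrite pair_bigA /=; apply: reindex => /=.
by exists (@mxtens_unindex k m) => s _; rewrite ?mxtens_indexK ?mxtens_unindexK //; case: s.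
Qed.

Lemma block_rowsE k m t (u : 'rV[F]_(k * m)) b :
  (cst_mx u *m block_rows k m t) 0 b = \sum_i u 0 (mxtens_index (i, b)) *: t i.
Proof.
rewrite mxE sum_mxtens; apply: eq_bigr => i _; rewrite (bigD1 b) //= big1.
  by rewrite !mxE mxtens_indexK eqxx mulr1n mul_polyC addr0.
by move=> a ab; rewrite !mxE mxtens_indexK (negPf ab) mulr0n mulr0.
Qed.

Lemma row_block_rows k m t s b :
  row s (block_rows k m t) 0 b = t (mxtens_unindex s).1 *+ ((mxtens_unindex s).2 == b).
Proof. by rewrite !mxE. Qed.

Definition size_le m k (a : 'rV[{poly F}]_m) := forall j, (size (a 0%R j) <= k)%N.

Lemma basis_rows_monomials k m :
  basis_rows (@size_le m k) (block_rows k m (fun i => 'X^i)).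
Proof.
have coefU (u : 'rV[F]_(k * m)) b (i : 'I_k) :
    (\sum_(i < k) u 0 (mxtens_index (i, b)) *: 'X^i)`_i
      = u 0 (mxtens_index (i, b)).
  rewrite coef_sum (bigD1 i) //= big1 ?addr0 => [|l li].
    by rewrite coefZ coefXn eqxx mulr1.
  by rewrite coefZ coefXn eq_sym (inj_eq val_inj) (negPf li) mulr0.
split=> [u /rowP u0|a].
  apply/rowP=> s; case: (mxtens_indexP s) => i b.
  by have := u0 b; rewrite block_rowsE -coefU => ->; rewrite !mxE coef0.
split=> [sa|[u ->] b]; last first.
  rewrite block_rowsE; apply: (leq_trans (size_sum _ _ _)).
  apply/bigmax_leqP => i _; apply: leq_trans (size_scale_leq _ _) _.
  by rewrite size_polyXn.
exists (\row_s (a 0 (mxtens_unindex s).2)`_(mxtens_unindex s).1).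
apply/rowP=> b; rewrite block_rowsE.
under eq_bigr => i _ do rewrite mxE mxtens_indexK.
rewrite -(poly_def _ (fun i => (a 0 b)`_i)); apply/polyP=> i.
by rewrite coef_poly; case: ltnP => // ki; rewrite nth_default // (leq_trans (sa b)).
Qed.

End Coordinates.

(** * Divided differences and Bezoutians *)

Section BezoutIdentity.
Variable F : fieldType.
Implicit Types (f w p : {poly F}).

Lemma drop_polyS f l : 'X * drop_poly l.+1 f = drop_poly l f - (f`_l)%:P.
Proof.
apply/polyP=> i; rewrite coefXM coefB coefC !coef_drop_poly.
by case: i => [|i] /=; rewrite ?subrr // subr0 addSnnS.
Qed.

(** Here ['X%:P] is x and ['X] is y: the quotient of [f(x) - f(y)] by [x - y] has coefficient
    [drop_poly l.+1 f] at [y^l]. Cutting the sum at [k] permits induction. *)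
Lemma divided_difference f k :
  ('X%:P - 'X) * \sum_(l < k) (drop_poly l.+1 f)%:P * 'X^l
  = f%:P - map_poly polyC (take_poly k f) - (drop_poly k f)%:P * 'X^k.
Proof.
elim: k => [|k IHk].
  by rewrite big_ord0 mulr0 take_poly0l rmorph0 drop_poly0l expr0 mulr1 subr0 subrr.
have takeS : take_poly k.+1 f = take_poly k f + (f`_k)%:P * 'X^k.
  apply/polyP=> i; rewrite coefD coefCM coefXn !coef_take_poly ltnS.
  by case: ltngtP => [||->]; rewrite ?mulr0 ?addr0 ?mulr1 ?add0r.
rewrite big_ord_recr /= mulrDr {}IHk takeS rmorphD rmorphM /= map_polyC map_polyXn.
have -> : (drop_poly k f)%:P = 'X%:P * (drop_poly k.+1 f)%:P + (f`_k)%:P%:P.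
  by rewrite -polyCM drop_polyS polyCB subrK.
by rewrite exprS; ring.
Qed.

Lemma divided_difference_full f k : (size f <= k.+1)%N ->
  ('X%:P - 'X) * \sum_(l < k) (drop_poly l.+1 f)%:P * 'X^l
  = f%:P - map_poly polyC f.
Proof.
move=> sf; rewrite divided_difference -addrA -opprD.
congr (_ - _); rewrite -[in RHS](poly_take_drop k f) rmorphD rmorphM /= map_polyXn.
suff /size1_polyC -> : (size (drop_poly k f) <= 1)%N by rewrite map_polyC.
by rewrite size_drop_poly leq_subLR addn1.
Qed.

(* Coefficients in [y] of [(w(x) p(y) - w(y) p(x)) / (x - y)]. *)
Lemma bezout_coef k w p (beta : 'I_k -> {poly F}) :
  (size w <= k.+1)%N -> (size p <= k.+1)%N ->
  ('X%:P - 'X) * (\sum_(i < k) (beta i)%:P * 'X^(k.-1 - i))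
    = w%:P * map_poly polyC p - map_poly polyC w * p%:P ->
  forall i : 'I_k, beta i
    = drop_poly k (w * 'X^i) * p - w * drop_poly k (p * 'X^i).
Proof.
move=> sw sp bezout i.
have XY0 : 'X%:P - 'X != 0 :> {poly {poly F}}.
  by rewrite -oppr_eq0 opprB polyXsubC_eq0.
(* From [w(x) p(y) - w(y) p(x) = (w(x) - w(y)) p(x) - w(x) (p(x) - p(y))]. *)
pose gam l : {poly F} := drop_poly l.+1 w * p - w * drop_poly l.+1 p.
have sumE : \sum_(i < k) (beta i)%:P * 'X^(k.-1 - i) = \sum_(l < k) (gam l)%:P * 'X^l.
  apply: (mulfI XY0); rewrite bezout.
  transitivity (('X%:P - 'X) * (\sum_(l < k) (drop_poly l.+1 w)%:P * 'X^l) * p%:P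
      - w%:P * (('X%:P - 'X) * \sum_(l < k) (drop_poly l.+1 p)%:P * 'X^l)).
    by rewrite !divided_difference_full //; ring.
  rewrite [w%:P * _]mulrCA -mulrA -mulrBr; congr (_ * _).
  rewrite mulr_suml mulr_sumr -sumrB; apply: eq_bigr => l _.
  by rewrite /gam polyCB !polyCM mulrBl !mulrA [_ * 'X^l * _]mulrAC.
have ik : (k.-1 - i < k)%N.
  by have := ltn_ord i; lia.
have := congr1 (fun q : {poly {poly F}} => q`_(k.-1 - i)) sumE.
rewrite !coef_sum (bigD1 i) //= big1 => [|j ji].
  rewrite addr0 coefCM coefXn eqxx mulr1 => ->.
  rewrite (bigD1 (Ordinal ik)) //= big1 => [|j ji].
    rewrite addr0 coefCM coefXn eqxx mulr1 /gam.
    have -> : (k.-1 - i).+1 = (k - i)%N.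
      by have := ltn_ord i; lia.
    (* This form is linear in ['X^i], and so extends from monomials to any [U]. *)
    have dE f : drop_poly (k - i) f = drop_poly k (f * 'X^i).
      rewrite drop_polyMXn (_ : (i - k)%N = 0) ?expr0 ?mulr1 //.
      by apply/eqP; rewrite subn_eq0 ltnW.
    by rewrite !dE.
  rewrite coefCM coefXn; case: eqP => [e|]; last by rewrite mulr0.
  by case/negP: ji; apply/eqP/val_inj.
rewrite coefCM coefXn; case: eqP => [e|]; last by rewrite mulr0.
case/negP: ji; apply/eqP/val_inj => /=.
by have := ltn_ord i; have := ltn_ord j; lia.
Qed.

End BezoutIdentity.

(** * The pencil evaluated at [lam] *)

Section DLEvaluation.
Variables (F : fieldType) (m n k : nat) (P : 'M[{poly F}]_(m, n)) (v : {poly F}).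
Variables (L : 'M[{poly F}]_(k * m, k * n)) (lam : F).
Hypothesis defL : is_DL P v L.
Local Notation B := (eval_mx L lam).
Local Notation w := (('X - lam%:P) * v).

Definition eval_z : {rmorphism {poly {poly {poly F}}} -> {poly {poly F}}} :=
  map_poly (map_poly (horner_eval lam)).

Lemma eval_z_subst3 t p :
  eval_z (subst3 t p) = (map_poly (polyC \o polyC) p).[eval_z t].
Proof.
rewrite /subst3 -horner_map -map_poly_comp; congr (_.[_]).
apply: eq_map_poly => c /=.
by rewrite map_polyC /= map_polyC /= /horner_eval hornerC.
Qed.

Lemma eval_zX : eval_z (X3 F) = 'X%:P.
Proof. by rewrite /eval_z /X3 /= map_polyC /= map_polyX. Qed.

Lemma eval_zY : eval_z (Y3 F) = 'X.
Proof. by rewrite /eval_z /Y3 /= map_polyX. Qed.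

Lemma eval_zZ : eval_z (Z3 F) = lam%:P%:P.
Proof. by rewrite /eval_z /Z3 /= map_polyC /= map_polyC /= /horner_eval hornerX. Qed.

Lemma substX (p : {poly F}) : (map_poly (polyC \o polyC) p).['X%:P] = p%:P :> {poly {poly F}}.
Proof. by rewrite map_poly_comp horner_map /= -[_.['X]]/(p \Po 'X) comp_polyXr. Qed.

Lemma substY (p : {poly F}) : (map_poly (polyC \o polyC) p).['X] = map_poly polyC p :> {poly {poly F}}.
Proof. by rewrite map_poly_comp -[_.['X]]/(map_poly polyC p \Po 'X) comp_polyXr. Qed.

Lemma substZ (p : {poly F}) : (map_poly (polyC \o polyC) p).[lam%:P%:P] = p.[lam]%:P%:P :> {poly {poly F}}.
Proof. by rewrite map_poly_comp !horner_map. Qed.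

(* The coefficient of [y^(k-1-i)] in entry [(a, b)] of [L(lam)] sandwiched between
   the vectors [V(y)] and [V(x)]. *)
Definition beta a b (i : 'I_k) : {poly F} :=
  \sum_(j < k) B (mxtens_index (i, a)) (mxtens_index (j, b)) *: 'X^(k.-1 - j).

(** Put [z = lam] in the defining identity: [(x - z) v(x)] becomes [w(x)]. *)
Lemma DL_bezout a b :
  ('X%:P - 'X) * (\sum_(i < k) (beta a b i)%:P * 'X^(k.-1 - i))
  = w%:P * map_poly polyC (P a b) - map_poly polyC w * (P a b)%:P.
Proof.
have [_ /matrixP/(_ a b)] := defL.
rewrite [LHS]mxE castmxE /=.
have castE l (c : 'I_l) : cast_ord (esym (mul1n l)) c = mxtens_index (0, c).
  by apply: val_inj.
rewrite !castE mxE sum_mxtens => /(congr1 eval_z).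
rewrite rmorphM rmorphB eval_zX eval_zY => bez.
transitivity (eval_z (X3 F - Y3 F) * \sum_j \sum_c eval_z
  (((((Vvec k (Y3 F))^T *t 1%:M) *m subst3_mx (Z3 F) L) (mxtens_index (0, a)) (mxtens_index (j, c)))
    * ((Vvec k (X3 F)) *t 1%:M) (mxtens_index (j, c)) (mxtens_index (0, b)))).
  rewrite rmorphB eval_zX eval_zY; congr (_ * _).
  transitivity (\sum_(j < k) \sum_(i < k) (B (mxtens_index (i, a)) (mxtens_index (j, b)))%:P%:P
     * 'X^(k.-1 - i) * ('X^(k.-1 - j))%:P :> {poly {poly F}}).
    rewrite exchange_big; apply: eq_bigr => i _ /=.
    rewrite /beta rmorph_sum mulr_suml; apply: eq_bigr => j _ /=.
    by rewrite -mul_polyC rmorphM /= mulrAC.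
  (* The identity factors of the Kronecker products single out column [b] and row [a] of each
     block. *)
  apply: eq_bigr => j _; rewrite (bigD1 b) //= [X in _ + X]big1 ?addr0; last first.
    by move=> c cb; rewrite tensmxE [(1%:M : 'M_n) c b]mxE (negPf cb) !mulr0 rmorph0.
  rewrite mxE sum_mxtens tensmxE [(1%:M : 'M_n) b b]mxE eqxx mulr1 mulr_suml rmorph_sum.
  apply: eq_bigr => i _ /=.
  rewrite (bigD1 a) //= big1 ?addr0; last first.
    by move=> c ca; rewrite tensmxE [(1%:M : 'M_m) a c]mxE eq_sym (negPf ca) mulr0 mul0r.
  rewrite tensmxE [(1%:M : 'M_m) a a]mxE eqxx mulr1 !mxE !rmorphM !rmorphXn.
  rewrite eval_zX eval_zY eval_z_subst3 eval_zZ substZ.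
  by rewrite -mulrA mulrCA mulrA.
rewrite rmorphB eval_zX eval_zY.
under eq_bigr => j _ do rewrite -rmorph_sum.
rewrite -rmorph_sum bez !mxE rmorphB !rmorphM !rmorphB.
rewrite !eval_z_subst3 eval_zX eval_zY eval_zZ !substX !substY /=.
by rewrite map_polyX map_polyC.
Qed.

End DLEvaluation.

(** * The left kernel of the evaluated pencil *)

Section Kernel.
Variables (F : fieldType) (m n k : nat) (P : 'M[{poly F}]_(m, n)) (v : {poly F}).
Variables (L : 'M[{poly F}]_(k * m, k * n)) (lam : F).
Hypothesis defL : is_DL P v L.
Hypothesis gradeP : grade_le k P.
Hypothesis size_v : (size v <= k)%N.
Hypothesis v_neq0 : v != 0.
Local Notation B := (eval_mx L lam).
Local Notation w := (('X - lam%:P) * v).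

Variable g : {poly F}.
Hypothesis size_g : size g = k.+1.
Hypothesis coprime_gw : coprimep g w.

Local Notation D := (drop_poly k).
Local Notation rows t := (block_rows k m t).

Let size_w : (size w <= k.+1)%N.
Proof. by rewrite size_monicM ?monicXsubC // size_XsubC. Qed.

Let w_neq0 : w != 0. Proof. by rewrite mulf_neq0 ?polyXsubC_eq0. Qed.

Let g_neq0 : g != 0. Proof. by rewrite -size_poly_gt0 size_g. Qed.

(** Since [D q * 'X^k] is [q] minus its part of degree below [k], the full products cancel in
    [e * 'X^k]. Only low parts times factors of grade [k] remain, of degree below [2k]. *)
Lemma size_bezout (I : finType) (f : {poly F}) (U p : I -> {poly F}) :
  (size f <= k.+1)%N -> (forall i, size (p i) <= k.+1)%N ->
  (size (f * D (\sum_i U i * p i)%R - \sum_i D (f * U i) * p i)%R <= k)%N.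
Proof.
move=> sf sp; set e := _ - _.
have dropE q : D q * 'X^k = q - take_poly k q.
  by apply/eqP; rewrite eq_sym subr_eq addrC poly_take_drop.
have : e * 'X^k = \sum_i take_poly k (f * U i) * p i
                   - f * take_poly k (\sum_i U i * p i).
  have sumE : (\sum_i D (f * U i) * p i) * 'X^k
      = f * (\sum_i U i * p i) - \sum_i take_poly k (f * U i) * p i.
    rewrite mulr_suml mulr_sumr -sumrB; apply: eq_bigr => i _.
    by rewrite mulrAC dropE mulrBl mulrA.
  by rewrite mulrBl sumE -mulrA dropE mulrBr; ring.
have bound (q1 q2 : {poly F}) : (size q1 <= k -> size q2 <= k.+1 ->
    size (q1 * q2)%R <= k + k)%N.
  move=> s1 s2; apply: (leq_trans (size_polyMleq _ _)).
  by have := leq_add s1 s2; rewrite addnS; case: (_ + _)%N.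
move=> eE; have : (size (e * 'X^k)%R <= k + k)%N.
  rewrite eE; apply: (leq_trans (size_polyD _ _)); rewrite size_polyN geq_max.
  rewrite [f * _]mulrC bound ?size_take_poly // andbT.
  apply: (leq_trans (size_sum _ _ _)); apply/bigmax_leqP => i _.
  by rewrite bound ?size_take_poly.
have [->|e0] := eqVneq e 0; first by rewrite size_poly0.
by rewrite size_mulXn // leq_add2l.
Qed.

Lemma block_rows_drop (u : 'rV[F]_(k * m)) f a :
  (cst_mx u *m rows (fun i => D (f * 'X^i))) 0 a
  = D (f * (cst_mx u *m rows (fun i => 'X^i)) 0 a).
Proof.
rewrite !block_rowsE mulr_sumr drop_poly_sum; apply: eq_bigr => i _.
by rewrite -scalerAr drop_polyZ.
Qed.

(** Linear extension of [bezout_coef] from the monomials ['X^i] to the row [U]. *)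
Lemma DL_row (u : 'rV[F]_(k * m)) b :
  \sum_(j < k) (u *m B) 0 (mxtens_index (j, b)) *: 'X^(k.-1 - j)
  = (cst_mx u *m rows (fun i => D (w * 'X^i)) *m P) 0 b
    - w * D ((cst_mx u *m rows (fun i => 'X^i) *m P) 0 b).
Proof.
transitivity (\sum_a \sum_i u 0 (mxtens_index (i, a)) *: beta L lam a b i).
  rewrite exchange_big /=.
  under eq_bigr => j _ do rewrite mxE sum_mxtens scaler_suml.
  rewrite exchange_big; apply: eq_bigr => i _ /=.
  under eq_bigr => j _ do rewrite scaler_suml.
  rewrite exchange_big; apply: eq_bigr => a _ /=.
  rewrite scaler_sumr; apply: eq_bigr => j _.
  by rewrite scalerA.
rewrite !mxE drop_poly_sum mulr_sumr -sumrB; apply: eq_bigr => a _.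
rewrite block_rows_drop block_rowsE mulr_sumr drop_poly_sum !mulr_suml.
rewrite drop_poly_sum mulr_sumr -sumrB; apply: eq_bigr => i _.
rewrite (bezout_coef size_w (gradeP a b) (DL_bezout lam defL a b)).
rewrite -scalerAr -[_ *: 'X^i * _]scalerAl !drop_polyZ -scalerAl -scalerAr -scalerBr.
by rewrite ['X^i * _]mulrC.
Qed.

(** The image of ['X^i] under [U |-> g D(w U) - w D(g U)]: a row of the scalar Bezoutian of [w] and
    [g]. *)
Definition tau i := g * D (w * 'X^i) - w * D (g * 'X^i).

Lemma size_tau i : (size (tau i) <= k)%N.
Proof.
have := @size_bezout 'I_1 g (fun => 'X^i) (fun => w).
rewrite !big_ord1 /tau [w * D _]mulrC [w * 'X^i]mulrC.
by apply=> //; rewrite size_g.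
Qed.

Lemma tauE (u : 'rV[F]_(k * m)) :
  cst_mx u *m rows tau = g *: (cst_mx u *m rows (fun i => D (w * 'X^i)))
                       - w *: (cst_mx u *m rows (fun i => D (g * 'X^i))).
Proof.
apply/rowP=> a; rewrite block_rowsE !mxE -/(mulmx _ _ 0 a).
have E t : \sum_j cst_mx u 0 j * rows t j a
     = \sum_i u 0 (mxtens_index (i, a)) *: t i.
  by rewrite -block_rowsE mxE.
rewrite !E !mulr_sumr -sumrB; apply: eq_bigr => i _.
by rewrite -!scalerAr -scalerBr.
Qed.

(** If [g D(w U) = w D(g U)], coprimality makes [g] divide [D(g U)]. For nonzero [U] the latter is
    nonzero, with the degree of [U], which is below that of [g]. *)
Lemma basis_rows_tau : basis_rows (@size_le F m k) (rows tau).
Proof.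
apply: basis_rows_square (basis_rows_monomials F k m) _ _ => [u|s b]; last first.
  rewrite row_block_rows; case: (_ == b); first exact: size_tau.
  by rewrite size_poly0.
rewrite tauE => /rowP u0; apply: (proj1 (basis_rows_monomials F k m)).
set U := cst_mx u *m _; apply/rowP=> a; rewrite [RHS]mxE; apply/eqP.
apply: contraT => Ua0.
have sU : (size (U 0%R a) <= k)%N.
  by move: a {Ua0}; apply/(proj2 (basis_rows_monomials F k m)); exists u.
have sgU : size (g * U 0 a) = (k + size (U 0%R a))%N.
  by rewrite size_mul // size_g.
have : g * D (w * U 0 a) = w * D (g * U 0 a).
  by apply/eqP; rewrite -subr_eq0 -!block_rows_drop; have := u0 a; rewrite !mxE => ->.
move/(congr1 (dvdp g)); rewrite dvdp_mulr // => /esym.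
rewrite Gauss_dvdpr // => /dvdp_leq le_g.
have Dg0 : D (g * U 0 a) != 0.
  by rewrite -size_poly_gt0 size_drop_poly sgU addKn size_poly_gt0.
by have := le_g Dg0; rewrite size_g size_drop_poly sgU addKn leqNgt ltnS sU.
Qed.

(** All rests on the identity [key], in which [uB] is the row [u *m B] in polynomial form. If [uB]
    is zero, [b0] is the required quotient. Conversely [g] divides [b - b0], which has degree below
    [k] and therefore vanishes. *)
Lemma DL_kernel (u : 'rV[F]_(k * m)) :
  u *m B = 0 <-> left_syzygy k P k w (cst_mx u *m rows tau).
Proof.
set U := cst_mx u *m rows (fun i => 'X^i).
pose DgU := cst_mx u *m rows (fun i => D (g * 'X^i)).
pose b0 : 'rV_n := \row_b (g * D ((U *m P) 0 b) - (DgU *m P) 0 b).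
pose uB b := \sum_(j < k) (u *m B) 0 (mxtens_index (j, b)) *: 'X^(k.-1 - j).
have sb0 b : (size (b0 0%R b) <= k)%N.
  have -> : b0 0 b = g * D (\sum_a U 0 a * P a b) - \sum_a D (g * U 0 a) * P a b.
    rewrite mxE; congr (_ * D _ - _); rewrite mxE //.
    by apply: eq_bigr => a _; rewrite block_rows_drop.
  by apply: size_bezout => [|a]; rewrite ?size_g.
have key b : (cst_mx u *m rows tau *m P) 0 b = w * b0 0 b + g * uB b.
  rewrite tauE mulmxBl -!scalemxAl /uB DL_row -/U [b0 0 b]mxE -/DgU.
  rewrite [in LHS]mxE [X in X + _ = _]mxE [X in _ + X = _]mxE [X in _ - X = _]mxE.
  by ring.
split=> [u0|[_ [b sb bE]]].
  split; first by apply/(proj2 basis_rows_tau); exists u.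
  exists b0 => //; apply/rowP=> b; rewrite key [RHS]mxE /uB u0 big1 ?mulr0 ?addr0 //.
  by move=> j _; rewrite mxE scale0r.
have uB0 c : uB c = 0.
  have E : w * (b 0 c - b0 0 c) = g * uB c.
    rewrite mulrBr; have := key c; rewrite bE mxE => ->.
    by rewrite addrC addKr.
  have bb0 : b 0 c - b0 0 c = 0.
    apply/eqP; apply: contraT => bb0.
    have /dvdp_leq : g %| b 0 c - b0 0 c.
      by rewrite -(Gauss_dvdpr _ coprime_gw) E dvdp_mulr.
    move/(_ bb0); rewrite size_g leqNgt ltnS => /negP[].
    apply: (leq_trans (size_polyD _ _)); rewrite size_polyN geq_max.
    by rewrite sb sb0.
  by apply: (mulfI g_neq0); rewrite -E bb0 !mulr0.
apply/rowP=> s; case: (mxtens_indexP s) => j c; rewrite [RHS]mxE.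
have := congr1 (fun q : {poly F} => q`_(k.-1 - j)) (uB0 c).
rewrite coef0 /uB coef_sum (bigD1 j) //= big1 => [|l lj].
  by rewrite coefZ coefXn eqxx mulr1 addr0.
rewrite coefZ coefXn; case: eqP => [e|]; last by rewrite mulr0.
case/negP: lj; apply/eqP/val_inj => /=.
by have := ltn_ord l; have := ltn_ord j; lia.
Qed.

End Kernel.

(** * Rank of the pencil and the isomorphism *)

Section Main.
Variable F : closedFieldType.

Lemma rank_DL_eval m n k (P : 'M[{poly F}]_(m, n)) (v : {poly F})
    (L : 'M[{poly F}]_(k * m, k * n)) lam :
  (0 < k)%N -> grade_le k P -> ansatz k.-1 v -> is_DL P v L ->
  (forall mu, ~~ (eigenvalue_at k P mu && root_at k.-1 v mu)) ->
  \rank (eval_mx L lam)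
  = (\rank (eval_mx P lam) + k.-1 * \rank (frac_mx P))%N.
Proof.
move=> k_gt0 gradeP ansv defL disj; have [v0] := andP ansv.
rewrite prednK // => sv; set w := ('X - lam%:P) * v.
have w0 : w != 0 by rewrite mulf_neq0 ?polyXsubC_eq0.
have /closed_nonrootP[c wc] := w0.
(* Any [g] of degree [k] coprime to [w] will do; a power at a nonroot of [w] is one. *)
pose g : {poly F} := ('X - c%:P) ^+ k.
have sg : size g = k.+1 by rewrite size_exp_XsubC.
have cgw : coprimep g w.
  by rewrite coprimep_expl // coprimep_sym coprimep_XsubC.
have dimS := has_dim_syzygy gradeP lam k_gt0 ansv disj.
have := has_dim_kernel (basis_rows_tau m sv v0 sg cgw) _ dimS
          (DL_kernel defL gradeP sv v0 sg cgw).
move=> /(_ (fun a => @proj1 _ _)).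
(* These bounds make the truncated subtractions of the dimension count exact. *)
have := rank_leq_row (eval_mx L lam); have := rank_leq_row (frac_mx P).
have := rank_eval_le P lam.
move: (\rank (eval_mx L lam)) (\rank (eval_mx P lam)) (\rank (frac_mx P)).
case: k k_gt0 {ansv L defL disj dimS gradeP sv g sg cgw} => //= l _ rL rt r.
move=> le_tr le_rm le_Lm; rewrite mulnBr mulSn => dimE.
have := leq_mul (leqnn l) le_rm; rewrite mulSn in le_Lm.
by move: (l * m)%N (l * r)%N dimE le_Lm => x y; lia.
Qed.

End Main.

Theorem corollary6p9 (F : closedFieldType) (charF0 : [pchar F] =i pred0)
    (m n k : nat) (k_ge2 : (2 <= k)%N)
    (P : 'M[{poly F}]_(m, n)) (gradeP : grade_le k P)
    (v : {poly F}) (ansatz_v : ansatz k.-1 v)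
    (L : 'M[{poly F}]_(k * m, k * n)) (defL : is_DL P v L)
    (disj : forall mu : option F, ~~ (eigenvalue_at k P mu && root_at k.-1 v mu))
    (lam : F) (v_lam : v.[lam] != 0)
    (r : nat) (M : 'M[{poly F}]_(n, r)) (minM : right_minimal_basis P M)
    (s : nat) (N : 'M[{poly F}]_(k * n, s)) (minN : right_minimal_basis L N) :
  lin_isomorphic
    (quotv (kerv (eval_mx P lam)) (ker_at M lam))
    (quotv (kerv (eval_mx L lam)) (ker_at N lam)).
Proof.
have k_gt0 : (0 < k)%N by rewrite (leq_trans _ k_ge2).
have rkL t := rank_DL_eval t k_gt0 gradeP ansatz_v defL disj.
have rk_fracL : \rank (frac_mx L) = (k * \rank (frac_mx P))%N.
  (* The formula is read at a point where neither [P] nor [L] loses rank. *)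
  have [h h0 rkP] := rank_eval_generic P.
  have [t ht <-] := exists_generic L h0.
  by rewrite rkL rkP // -[in RHS](prednK k_gt0) mulSn.
apply: quotv_isomorphic; [exact: ker_at_sub minM | exact: ker_at_sub minN |].
rewrite !dim_kerv (dim_ker_at lam minM) (dim_ker_at lam minN) rk_fracL rkL.
(* Both differences of dimensions equal the rank of [P] minus that of [P(lam)]. *)
have := rank_eval_le P lam; have := rank_leq_col (frac_mx P).
move: (\rank (eval_mx P lam)) (\rank (frac_mx P)).
case: k k_gt0 {k_ge2 gradeP ansatz_v L defL disj N minN rkL rk_fracL} => //= l _.
move=> rt r0 le_rn le_tr; rewrite !mulSn; have := leq_mul (leqnn l) le_rn.
by move: (l * n)%N (l * r0)%N => x y; lia.
Qed.
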